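(* Let $d\geq 3$, let $|\Omega|=3d+1$, let $A\subseteq\Omega$ with $|A|=a$, and put $a'=\min(a,3d+1-a)$. The admissible loopless type-invariant binary voltage assignments on $K(3d+1,d)$ (with respect to $A$), modulo gauge, have canonical coordinates (in the sense made precise in the context) indexed by the integer triples $(k,i,j)$ with \[ 0\leq k<i<j\leq d-1,\qquad k+i+j=a'-2 . \] The quotient space has dimension \[ \dim H^1(Y_{d,a'};\mathbb F_2)=|F_{d,a'}|=[q^{a'-5}]\binom{d}{3}_q . \] Moreover, two type-invariant voltages that differ by a coboundary on the full Kneser graph $K(3d+1,d)$ already differ by a type coboundary.
   Context: $G=K(3d+1,d)$ is the Kneser graph whose vertices are the $d$-subsets of $\Omega$, adjacent iff disjoint. A binary voltage is a function $\alpha:E(G)\to\mathbb F_2$ on unoriented edges. Its lift $\widetilde G_\alpha$ has vertex set $V(G)\times\mathbb F_2$, with $(u,\epsilon)\sim(v,\eta)$ iff $uv\in E(G)$ and $\eta=\epsilon+\alpha(uv)$; the projection is $(v,\epsilon)\mapsto v$. The lift preserves every open neighborhood if for every vertex $(x,i)$ the projection restricts to an isomorphism from the graph induced on the open neighborhood of $(x,i)$ to the graph induced on that of $x$. The type of a vertex $S$ is $t(S)=|S\cap A|$. A voltage is type-invariant if $\alpha(ST)$ depends only on the unordered pair $\{t(S),t(T)\}$, and loopless if $\alpha(ST)=0$ whenever $t(S)=t(T)$. Admissible means loopless, type-invariant, and such that the lift preserves every open neighborhood. A coboundary on the full Kneser graph is a voltage $ST\mapsto f(S)+f(T)$ with $f:V(G)\to\mathbb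 F_2$; a type coboundary (type switching) is a voltage $ST\mapsto s(t(S))+s(t(T))$ with $s$ an $\mathbb F_2$-valued function on types. ''Modulo gauge'' means modulo type coboundaries. Write $ij$ for $\{i,j\}$. For $0\le b\le(3d+1)/2$ put $u=\min(d,b)$ and $L=\max(0,b-d-1)$. The type complex $Y_{d,b}$ is the complex of dimension at most two with vertices $0,\dots,u$, edges the pairs of distinct vertices $i<j$ with $L\le i+j\le b$, and faces the triples of distinct vertices $i<j<k$ with $i+j+k\in\{b-1,b\}$. Put $T_{d,b}=\{0j:1\le j\le u\}$ if $L=0$, and $T_{d,b}=\{0j:L\le j\le d\}\cup\{id:1\le i<L\}$ if $L>0$. Put $F_{d,b}=\{ij: k=b-2-i-j,\ 0\le k<i<j\le d-1\}$. Canonical coordinates: let $A'=A$ if $a\le(3d+1)/2$ and $A'=\Omega\setminus A$ otherwise, and compute types with respect to $A'$ (complementing the block replaces type $i$ by $d-i$). Each gauge class contains exactly one voltage vanishing on all edges whose type pair lies in $T_{d,a'}$; the coordinate of the class at $(k,i,j)$ is the value of this representative on edges with type pair $ij\in F_{d,a'}$. That these are coordinates means that the resulting linear map from the quotient space to $\mathbb F_2^{F_{d,a'}}$ is an isomorphism. $\binom{d}{3}_q$ is the Gaussian binomial coefficient; $[q^m]f(q)$ is the coefficient of $q^m$, taken to be $0$ for $m<0$. *)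

(* Defs.v *)
From HB Require Import structures.
From mathcomp Require Import all_boot all_order all_algebra.
From mathcomp Require Import zify.

Set Implicit Arguments.
Unset Strict Implicit.
Unset Printing Implicit Defensive.

Import GRing.Theory.

Local Open Scope ring_scope.

(* Quotients of subspaces: quotv U V is the image of U under a linear         *)
(* endomorphism with kernel exactly V (the projection along V onto the        *)
(* library's complement of V), so for V <= U it is a copy of U / V whose      *)
(* class map quot_class U V is linear and onto, with fibres the cosets of V.  *)
Section QuotientSpace.

Variables (K : fieldType) (vT : vectType K).
Implicit Types (U V : {vspace vT}).

Definition quotv_map V : 'End(vT) := (\1 - projv V)%VF.

Definition quotv U V : {vspace vT} := (quotv_map V @: U)%VS.

Definition quot_class U V (v : vT) : subvs_of (quotv U V) :=
  vsproj (quotv U V) (quotv_map V v).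

Lemma lker_quotv_map V : lker (quotv_map V) = V.
Proof.
apply/vspaceP=> v; rewrite memv_ker add_lfunE opp_lfunE id_lfunE subr_eq0.
by apply/eqP/idP=> [->|/projv_id->//]; apply: memv_proj.
Qed.

Lemma quot_class_is_linear U V : linear (quot_class U V).
Proof. by move=> k u v; rewrite /quot_class !linearP. Qed.

Lemma quot_class_eq U V u v : u \in U -> v \in U ->
  (quot_class U V u == quot_class U V v) = (u - v \in V).
Proof.
move=> Uu Uv; rewrite -[in RHS](lker_quotv_map V) memv_ker linearB /= subr_eq0.
rewrite /quot_class; apply/eqP/eqP=> [/(congr1 vsval)|->//].
by rewrite !vsprojK ?memv_img.
Qed.

Lemma quot_class_onto U V q : exists2 u, u \in U & quot_class U V u = q.
Proof.
have /memv_imgP[u Uu Eu] := subvsP q.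
by exists u => //; apply/val_inj; rewrite /= vsprojK ?memv_img.
Qed.

Lemma dim_quotv U V : (V <= U)%VS -> \dim (quotv U V) = (\dim U - \dim V)%N.
Proof.
move=> sVU; rewrite -(limg_ker_dim (quotv_map V) U) lker_quotv_map.
by rewrite (capv_idPr sVU) addnC addnK.
Qed.

End QuotientSpace.

(* The F_2-space of those elements of a finite space satisfying P; it has     *)
(* exactly these elements as soon as P is closed under 0 and +.               *)
Section SpaceOf.

Variables (I : finType).
Implicit Types (P : pred {ffun I -> ('F_2)^o}).

Definition space_of P : {vspace {ffun I -> ('F_2)^o}} := <<enum P>>%VS.

Lemma mem_space_of P : P 0 -> (forall f g, P f -> P g -> P (f + g)) ->
  forall f, (f \in space_of P) = P f.
Proof.
move=> P0 PD f; apply/idP/idP=> [|Pf]; last first.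
  by apply: memv_span; rewrite mem_enum.
have PZ (k : 'F_2) g : P g -> P (k *: g).
  move=> Pg; case: k => [[|[|//]] lt_k2].
    by rewrite (_ : Ordinal _ = 0) ?scale0r //; apply/val_inj.
  by rewrite (_ : Ordinal _ = 1) ?scale1r //; apply/val_inj.
move=> /(@coord_span _ _ _ (in_tuple _))->.
apply: (big_ind P) => // i _; apply: PZ.
by rewrite -[P _]/(_ \in P) -mem_enum mem_nth.
Qed.

End SpaceOf.

(* Finite simple graphs, given by an adjacency relation (symmetric and        *)
(* irreflexive in all uses below), and their binary voltages.                 *)
Section Graph.

Variables (V : finType) (adj : rel V).

Definition is_edge (e : {set V}) :=
  [exists S, exists T, adj S T && (e == [set S; T])].

Definition edge := {e : {set V} | is_edge e}.

Definition voltage := {ffun edge -> ('F_2)^o}.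

Definition nbhd (x : V) : {set V} := [set y | adj x y].

(* For e = {S, T} with S != T the sum is f S + f T. *)
Definition coboundary (f : V -> ('F_2)^o) : voltage :=
  [ffun e : edge => \sum_(S in val e) f S : ('F_2)^o].

Definition lift_adj (alpha : voltage) : rel (V * 'F_2) :=
  fun x y => [exists e : edge,
    (val e == [set x.1; y.1]) && (y.2 == x.2 + alpha e)].

Hypotheses (adj_sym : symmetric adj) (adj_irr : irreflexive adj).

Lemma edgeP (x y : V) : reflect (exists e : edge, val e = [set x; y]) (adj x y).
Proof.
apply: (iffP idP) => [xy|[[e /= e_edge] Ee]].
  suff e_edge : is_edge [set x; y] by exists (exist (fun e => is_edge e) _ e_edge).
  by apply/existsP; exists x; apply/existsP; exists y; rewrite xy eqxx.
have /existsP[S /existsP[T /andP[ST /eqP]]] := e_edge; rewrite Ee => Exy.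
have neST : S != T by apply: contraTneq ST => ->; rewrite adj_irr.
have : S \in [set x; y] by rewrite Exy set21.
have : T \in [set x; y] by rewrite Exy set22.
have : x \in [set S; T] by rewrite -Exy set21.
have : y \in [set S; T] by rewrite -Exy set22.
rewrite !inE => /pred2P[]-> /pred2P[]->; rewrite ?eqxx ?(negPf neST) ?orbF //=.
- by rewrite eq_sym (negPf neST).
- by rewrite adj_sym.
Qed.

End Graph.

Definition induced_iso (V W : finType) (adjV : rel V) (adjW : rel W)
    (f : V -> W) (N : {set V}) (M : {set W}) : bool :=
  [&& f @: N == M, dinjectiveb f [in N]
    & [forall y in N, forall z in N, adjV y z == adjW (f y) (f z)]].

Definition preserves_nbhds (V : finType) (adj : rel V) (alpha : voltage adj) :=
  [forall x : V * 'F_2, induced_iso (lift_adj alpha) adj fst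
    (nbhd (lift_adj alpha) x) (nbhd adj x.1)].

Section NeighborhoodTriangles.

Variables (V : finType) (adj : rel V).
Hypotheses (adj_sym : symmetric adj) (adj_irr : irreflexive adj).

Lemma lift_adjP (alpha : voltage adj) x y :
  reflect (exists2 e, val e = [set x.1; y.1] & y.2 = x.2 + alpha e)
          (lift_adj alpha x y).
Proof.
apply: (iffP existsP) => [[e /andP[/eqP Ee /eqP Ey]]|[e Ee Ey]].
  by exists e.
by exists e; rewrite Ee Ey !eqxx.
Qed.

Lemma preserves_nbhdsP (alpha : voltage adj) :
  reflect (forall x y z exy eyz exz, val exy = [set x; y] ->
             val eyz = [set y; z] -> val exz = [set x; z] ->
             alpha exz = alpha exy + alpha eyz)
          (preserves_nbhds alpha).
Proof.
have adjE := edgeP adj_sym adj_irr.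
apply: (iffP forallP) => [lift_ok x y z exy eyz exz Exy Eyz Exz | tri [x i]].
  have /and3P[_ _ /forall_inP iso] := lift_ok (x, 0).
  have Ny : (y, alpha exy) \in nbhd (lift_adj alpha) (x, 0).
    by rewrite inE; apply/lift_adjP; exists exy => //=; rewrite add0r.
  have Nz : (z, alpha exz) \in nbhd (lift_adj alpha) (x, 0).
    by rewrite inE; apply/lift_adjP; exists exz => //=; rewrite add0r.
  have /forall_inP/(_ _ Nz)/eqP/= := iso _ Ny.
  have -> : adj y z by apply/adjE; exists eyz.
  by case/lift_adjP=> e /=; rewrite -Eyz => /val_inj->.
apply/and3P; split.
- apply/eqP/setP=> y; rewrite [RHS]inE; apply/imsetP/adjE => [[[z k]]|[e Ee]].
    by rewrite inE => /lift_adjP[e Ee _] ->; exists e.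
  by exists (y, i + alpha e); rewrite // inE; apply/lift_adjP; exists e.
- apply/dinjectiveP=> -[y j] [z k] Ny Nz /= Eyz.
  move: Ny Nz; rewrite -{z}Eyz !inE => /lift_adjP[e /= Ee ->].
  case/lift_adjP=> f /= Ef ->; congr (_, i + alpha _).
  by apply/val_inj; rewrite /= Ee.
apply/forall_inP=> -[y j]; rewrite inE => /lift_adjP[exy /= Exy ->].
apply/forall_inP=> -[z k]; rewrite inE => /lift_adjP[exz /= Exz ->].
apply/eqP=> /=; apply/lift_adjP/adjE => /= [[e Ee _]|[e Ee]]; exists e => //.
by rewrite -addrA; congr (_ + _); apply: tri Exy Ee Exz.
Qed.

End NeighborhoodTriangles.

Section Kneser.

Variables (Omega : finType) (d : nat).

Definition kvertex := {S : {set Omega} | #|S| == d}.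

Definition kadj : rel kvertex := fun S T => [disjoint val S & val T].

Lemma ktype_subproof (A : {set Omega}) (S : kvertex) :
  (#|val S :&: A| < d.+1)%N.
Proof. case: S => S /= /eqP cS.
by rewrite ltnS (leq_trans (subset_leq_card (subsetIl S A))) ?cS. Qed.

Definition ktype (A : {set Omega}) (S : kvertex) : 'I_d.+1 :=
  Ordinal (ktype_subproof A S).

(* The unordered pair of types of the ends of e, a singleton when they agree. *)
Definition edge_types (A : {set Omega}) (e : edge kadj) : {set 'I_d.+1} :=
  ktype A @: val e.

Definition type_invariant (A : {set Omega}) (alpha : voltage kadj) :=
  [forall e, forall e', (edge_types A e == edge_types A e') ==>
     (alpha e == alpha e')].

Definition loopless (A : {set Omega}) (alpha : voltage kadj) :=
  [forall e : edge kadj,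
     [forall S in val e, forall T in val e, ktype A S == ktype A T] ==>
     (alpha e == 0)].

Definition admissible (A : {set Omega}) (alpha : voltage kadj) :=
  [&& loopless A alpha, type_invariant A alpha & preserves_nbhds alpha].

Definition type_coboundary (A : {set Omega}) (s : 'I_d.+1 -> 'F_2) :
  voltage kadj := coboundary kadj (fun S => s (ktype A S)).

Definition is_type_coboundary (A : {set Omega}) (alpha : voltage kadj) :=
  [exists s : {ffun 'I_d.+1 -> 'F_2}, alpha == type_coboundary A s].

Definition admissible_space (A : {set Omega}) := space_of (admissible A).

Definition gauge_space (A : {set Omega}) := space_of (is_type_coboundary A).

Lemma kadj_sym : symmetric kadj.
Proof. by move=> S T; rewrite /kadj disjoint_sym. Qed.

Lemma kadj_irr : (0 < d)%N -> irreflexive kadj.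
Proof.
move=> d_gt0 S; apply: contraTF d_gt0; rewrite /kadj -setI_eq0 setIid.
by case: S => S /= /eqP<- /eqP->; rewrite cards0.
Qed.

Lemma type_coboundaryE (A : {set Omega}) s e S T : (0 < d)%N ->
  val e = [set S; T] ->
  type_coboundary A s e = s (ktype A S) + s (ktype A T) :> 'F_2.
Proof.
move=> d_gt0 Ee; have ST : kadj S T.
  by apply/(edgeP kadj_sym (kadj_irr d_gt0)); exists e.
have neST : S != T by apply: contraTneq ST => ->; rewrite kadj_irr.
by rewrite ffunE Ee big_setU1 ?big_set1 //= inE.
Qed.

Lemma mem_admissible_space (A : {set Omega}) alpha : (0 < d)%N ->
  (alpha \in admissible_space A) = admissible A alpha.
Proof.
move=> d_gt0; have tri := preserves_nbhdsP kadj_sym (kadj_irr d_gt0).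
apply: mem_space_of => [|f g].
  apply/and3P; split.
  - by apply/forall_inP=> e _; rewrite ffunE.
  - by apply/forallP=> e; apply/forall_inP=> e' _; rewrite !ffunE.
  - by apply/tri=> *; rewrite !ffunE addr0.
case/and3P=> /forall_inP l_f /forallP t_f /tri n_f.
case/and3P=> /forall_inP l_g /forallP t_g /tri n_g; apply/and3P; split.
- apply/forall_inP=> e ee.
  by rewrite ffunE (eqP (l_f e ee)) (eqP (l_g e ee)) addr0.
- apply/forallP=> e; apply/forall_inP=> e' ee'; rewrite !ffunE.
  by rewrite (eqP (implyP (forallP (t_f e) e') ee')) (eqP (implyP (forallP (t_g e) e') ee')).
apply/tri=> x y z exy eyz exz Exy Eyz Exz; rewrite !ffunE.
by rewrite (n_f _ _ _ _ _ _ Exy Eyz Exz) (n_g _ _ _ _ _ _ Exy Eyz Exz) addrACA.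
Qed.

Lemma mem_gauge_space (A : {set Omega}) alpha :
  (alpha \in gauge_space A) = is_type_coboundary A alpha.
Proof.
apply: mem_space_of => [|f g].
  apply/existsP; exists [ffun=> 0]; apply/eqP/ffunP=> e.
  by rewrite !ffunE big1 // => S _; rewrite ffunE.
case/existsP=> r /eqP-> /existsP[s /eqP->].
apply/existsP; exists [ffun t => r t + s t]; apply/eqP/ffunP=> e.
by rewrite !ffunE -big_split; apply: eq_bigr => S _; rewrite ffunE.
Qed.

Lemma gauge_sub_admissible (A : {set Omega}) : (0 < d)%N ->
  (gauge_space A <= admissible_space A)%VS.
Proof.
move=> d_gt0; have tri := preserves_nbhdsP kadj_sym (kadj_irr d_gt0).
have eE (e : edge kadj) : exists S T, val e = [set S; T].
  case: e => e /= /existsP[S /existsP[T /andP[_ /eqP Ee]]].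
  by exists S, T.
have F2D (x : 'F_2) : x + x = 0.
  by rewrite -mulr2n -mulr_natl pchar_Zp ?mul0r.
apply/subvP=> alpha; rewrite mem_gauge_space mem_admissible_space //.
case/existsP=> s /eqP->; apply/and3P; split.
- apply/forall_inP=> e /forall_inP same_t; have [S [T Ee]] := eE e.
  have := same_t S; rewrite Ee set21.
  rewrite (type_coboundaryE _ _ _ Ee) // => /(_ isT)/forall_inP/(_ T).
  by rewrite set22 => /(_ isT)/eqP->; rewrite F2D.
- apply/forallP=> e; apply/forall_inP=> e' /eqP.
  have [[S [T Ee]] [S' [T' Ee']]] := (eE e, eE e').
  rewrite /edge_types Ee Ee' !imsetU1 !imset_set1 => Et.
  rewrite (type_coboundaryE _ _ _ Ee) // (type_coboundaryE _ _ _ Ee') //.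
  have: ktype A S \in [set ktype A S'; ktype A T'] by rewrite -Et set21.
  have: ktype A T \in [set ktype A S'; ktype A T'] by rewrite -Et set22.
  have: ktype A S' \in [set ktype A S; ktype A T] by rewrite Et set21.
  have: ktype A T' \in [set ktype A S; ktype A T] by rewrite Et set22.
  move=> /set2P t1 /set2P t2 /set2P t3 /set2P t4; apply/eqP.
  case: t1 => ?; case: t2 => ?; case: t3 => ?; case: t4 => ?;
    try by congr (s _ + s _); congruence.
  by apply: etrans (addrC _ _) _; congr (s _ + s _); congruence.
apply/tri=> x y z exy eyz exz Exy Eyz Exz.
have F2c (p q r : 'F_2) : p + r = (p + q) + (q + r).
  by rewrite -addrA (addrA q q r) F2D add0r.
rewrite (type_coboundaryE _ _ _ Exy) // (type_coboundaryE _ _ _ Eyz) //.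
by rewrite (type_coboundaryE _ _ _ Exz) //; apply: F2c.
Qed.

End Kneser.

(* Simplicial cochains and cohomology with coefficients in F_2 (no signs) of  *)
(* an abstract simplicial complex, given as its set of nonempty simplices.    *)
Section Cohomology.

Variables (V : finType) (Y : {set {set V}}).

Definition simplex (k : nat) := {s : {set V} | (s \in Y) && (#|s| == k.+1)}.

Definition cochain (k : nat) := {ffun simplex k -> ('F_2)^o}.

Definition cochain_diff (k : nat) (f : cochain k) : cochain k.+1 :=
  [ffun s : simplex k.+1 =>
     \sum_(t : simplex k | val t \subset val s) f t : ('F_2)^o].

Lemma cochain_diff_is_linear k : linear (@cochain_diff k).
Proof.
move=> c f g; apply/ffunP=> s; rewrite !ffunE scaler_sumr -big_split /=.
by apply: eq_bigr => t _; rewrite !ffunE.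
Qed.

HB.instance Definition _ k := GRing.isLinear.Build _ _ _ _ (@cochain_diff k)
  (@cochain_diff_is_linear k).

Definition H1 : {vspace cochain 1} :=
  quotv (lker (linfun (@cochain_diff 1))) (limg (linfun (@cochain_diff 0))).

End Cohomology.

Section TypeComplex.

Variables (d b : nat).

Definition Ytop : nat := minn d b.
Definition Ylow : nat := b - d.+1.

Definition type_complex : {set {set 'I_Ytop.+1}} :=
  [set s : {set 'I_Ytop.+1} |
    let w := (\sum_(i in s) i)%N in
    [|| #|s| == 1%N,
        (#|s| == 2%N) && (Ylow <= w <= b)%N
      | (#|s| == 3%N) && ((w.+1 == b) || (w == b))]].

Lemma type_complex_closed (s t : {set 'I_Ytop.+1}) :
  s \in type_complex -> t \subset s -> t != set0 -> t \in type_complex.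
Proof.
rewrite !inE /= => Ys sts; rewrite -card_gt0 => t_gt0.
have le_ts := subset_leq_card sts.
have Es : (\sum_(i in s) i = \sum_(i in t) i + \sum_(i in s :\: t) i)%N.
  rewrite (big_setID t) /=; congr (_ + _)%N.
  by apply: eq_bigl => i; rewrite (setIidPr sts).
case: (eqVneq #|t| #|s|) => [Ets | neq_ts].
  have /eqP -> : t == s by rewrite eqEcard sts Ets leqnn.
  exact: Ys.
have lt_ts : (#|t| < #|s|)%N by rewrite ltn_neqAle neq_ts.
case/or3P: Ys => [/eqP cs | /andP[/eqP cs _] | /andP[/eqP cs Ews]].
- by rewrite cs ltnS leqNgt t_gt0 in lt_ts.
- by rewrite (_ : #|t| == 1%N) // eqn_leq t_gt0 andbT -ltnS -cs.
have [-> // | t_neq1] := eqVneq #|t| 1%N.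
have ct : #|t| = 2%N.
  by apply/eqP; rewrite eqn_leq -ltnS -cs lt_ts ltn_neqAle eq_sym t_neq1.
have cu : #|s :\: t| = 1%N by rewrite cardsD (setIidPr sts) cs ct.
have /eqP/cards1P[k Ek] := cu; rewrite Ek big_set1 in Es.
have le_kd : (k <= d)%N by rewrite (leq_trans _ (geq_minl d b)) // -ltnS.
rewrite ct /= orbF /Ylow; move: Ews le_kd; rewrite Es.
by move: (\sum_(i in t) i)%N (nat_of_ord k) => w m; lia.
Qed.

Definition Tset : {set {set 'I_d.+1}} :=
  if Ylow == 0%N then [set [set ord0; j] | j : 'I_d.+1 & (1 <= j <= Ytop)%N]
  else [set [set ord0; j] | j : 'I_d.+1 & (Ylow <= j <= d)%N]
       :|: [set [set i; ord_max] | i : 'I_d.+1 & (1 <= i < Ylow)%N].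

Definition is_ctriple (x : 'I_d.+1 * 'I_d.+1 * 'I_d.+1) :=
  let: (k, i, j) := x in
  [&& (k < i)%N, (i < j)%N, (j <= d.-1)%N & (k + i + j + 2 == b)%N].

Definition ctriple := {x | is_ctriple x}.

Definition triple_pair (x : ctriple) : {set 'I_d.+1} :=
  let: (k, i, j) := val x in [set i; j].

Definition Fset : {set {set 'I_d.+1}} := [set triple_pair x | x : ctriple].

End TypeComplex.

Section CanonicalCoordinates.

Variables (Omega : finType) (d : nat) (A : {set Omega}).

Definition canon_size : nat := minn #|A| (3 * d + 1 - #|A|).

Definition canon_block : {set Omega} :=
  if (2 * #|A| <= 3 * d + 1)%N then A else ~: A.

(* beta is a voltage of the gauge class of alpha vanishing on Tset.           *)
Definition canon_rep (alpha beta : voltage (@kadj Omega d)) : Prop :=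
  is_type_coboundary A (beta - alpha) /\
  forall e, edge_types canon_block e \in Tset d canon_size -> beta e = 0.

Definition gauge_quotient := quotv (admissible_space d A) (gauge_space d A).

Definition gauge_class (alpha : voltage (@kadj Omega d)) :
  subvs_of gauge_quotient :=
  quot_class (admissible_space d A) (gauge_space d A) alpha.

End CanonicalCoordinates.

(* The division is exact: the quotient has nonnegative integer coefficients.  *)
Definition gauss_binomial (n k : nat) : {poly rat} :=
  (\prod_(i < k) ('X^(n - i) - 1)) %/ (\prod_(i < k) ('X^(i.+1) - 1)).

Definition coefz (p : {poly rat}) (m : int) : rat :=
  if m is Posz n then p`_n else 0.

(* Main.v *)
Require Import Defs.
From HB Require Import structures.
From mathcomp Require Import all_boot all_order all_algebra.
From mathcomp Require Import zify ring.

Set Implicit Arguments.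
Unset Strict Implicit.
Unset Printing Implicit Defensive.

Import GRing.Theory.
Local Open Scope ring_scope.

(** Write [B] for the canonical block and [b] for its size, so [2 * b <= 3 * d + 1].
    Counting inside and outside [B] shows which types disjoint vertices can have:
    a pair [i], [j] occurs on an edge iff [b - d - 1 <= i + j <= b], and a triple
    occurs on a triangle iff its sum is [b - 1] or [b].  The lift preserves open
    neighborhoods iff the voltage sums to zero on every triangle, so an admissible
    voltage is a 1-cocycle of the type complex, gauge is its 1-coboundaries, and the
    quotient is [H^1].  Voltages and cochains are both treated through the
    functions [g i j] on increasing type pairs that they define:
    [quotient_coordinates] turns a statement about such functions into one about
    the quotient of any two spaces read by them.

    The combinatorial core is that a cocycle vanishing on the tree is freely and
    uniquely given by its values on the coordinate pairs.  Let [g] be such a cocycle,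
    [i < j] and [k = b - 2 - i - j].  Outer pairs ([i = 0], [j = d] or [k < 0]) have
    value zero: they are in the tree or lie in a triangle with two tree edges.  The
    inner pairs with [k < i] are the coordinate pairs.  For the inner pairs with
    [k >= i], fix [i].  The triangles with least vertex [i] join [i j] to [i j'] with
    [j' = b - 1 - i - j] or [j' = b - i - j], and the third edge [j j'] is outer or a
    coordinate pair (for these two, [k] becomes [i - 1] and [i - 2]).  The two involutions
    compose to a translation by one, so the pairs with least type [i] form a path.  At
    one of its ends an involution has a fixed point, where the triangle degenerates
    and imposes nothing.  The other end is an outer or a coordinate pair, or else it
    is the pair [i], [b - d - 1 - i], whose neighbor on the path is the outer pair
    [i d].  Running along the path from this known pair, each triangle determines
    exactly one new value.  Hence the values are forced ([cocycle_eq0]), and any values on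
    the coordinate pairs extend, by partial sums along the paths
    ([extend_coord_cocycle]).

    The number of coordinates is the number of 3-subsets of [{0, ..., d - 1}] of sum
    [b - 2], which has the Gaussian binomial as generating function after the shift by
    the least sum [3].  Finally any two vertices have a common neighbor, since their
    union misses at least [d + 1] points; so if the coboundary of [f] is
    type-invariant, then [f] takes equal values at vertices of equal type. *)

Local Notation F2 := (('F_2)^o).

(** * Sums in characteristic two *)

Lemma F2P (x : F2) : x = 0 \/ x = 1.
Proof. by case: x => [[|[|]]] //= lt; [left|right]; apply/val_inj. Qed.

(* Identities between sums in F_2 are checked on all values of the given terms. *)
Ltac f2 x := case: (F2P x) => ->.

Lemma F2_addxx (x : F2) : x + x = 0.
Proof. by apply/eqP; f2 x. Qed.

Lemma F2_eq0 (x y : F2) : x + y = 0 -> x = y.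
Proof. by f2 x; f2 y. Qed.

(** * Cocycles on pairs of types *)

Section TypePairs.

Variables d b : nat.
Implicit Types (g : nat -> nat -> F2) (s : nat -> F2).

(** The type pairs occurring on edges with ends of different types. *)
Definition type_edge i j :=
  [&& (i < j)%N, (j <= d)%N, (Ylow d b <= i + j)%N & (i + j <= b)%N].

Definition type_face i j l :=
  [&& (i < j)%N, (j < l)%N, (l <= d)%N
    & ((i + j + l).+1 == b) || (i + j + l == b)%N].

Definition tree_edge i j := (i < j)%N &&
  ((i == 0)%N && (Ylow d b <= j <= Ytop d b)%N || (0 < i < Ylow d b)%N && (j == d)).

(** When [i + j] exceeds [b - 2] the difference [k] is truncated to [0]; the last
    condition then fails. *)
Definition coord_edge i j :=
  let k := (b - 2 - i - j)%N in
  [&& (k < i)%N, (i < j)%N, (j <= d.-1)%N & (k + i + j + 2 == b)%N].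

Definition type_cocycle g :=
  forall i j l, type_face i j l -> g i l = g i j + g j l.

(** The value at [i] of the potential that vanishes at [0] and whose coboundary
    agrees with [g] on the tree. *)
Definition tree_potential g i : F2 :=
  if i == 0%N then 0 else if (i < Ylow d b)%N then g i d + g 0%N d else g 0%N i.

Definition normalize g i j : F2 :=
  g i j + tree_potential g i + tree_potential g j.

Lemma coord_edge_type i j : coord_edge i j -> type_edge i j.
Proof. by rewrite /coord_edge /type_edge /Ylow; lia. Qed.

Lemma cocycle_normalize g : type_cocycle g -> type_cocycle (normalize g).
Proof.
move=> cg i j l /cg; rewrite /normalize => ->.
apply/eqP.
by f2 (g i j); f2 (g j l); f2 (tree_potential g i); f2 (tree_potential g j);
  f2 (tree_potential g l).
Qed.

Hypothesis b_half : (2 * b <= 3 * d + 1)%N.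

Lemma tree_edge_type i j : tree_edge i j -> type_edge i j.
Proof. by rewrite /tree_edge /type_edge /Ytop /Ylow; lia. Qed.

Lemma normalize_tree g i j : tree_edge i j -> normalize g i j = 0.
Proof.
move=> /andP[lt_ij /orP[/andP[/eqP i0 /andP[Lj ju]]|/andP[/andP[i_gt0 iL] /eqP jd]]].
  rewrite /normalize /tree_potential i0 /= addr0.
  have -> : (j == 0)%N = false by lia.
  by rewrite ltnNge Lj /= F2_addxx.
rewrite /normalize /tree_potential jd.
have -> : (i == 0)%N = false by lia.
have -> : (d == 0)%N = false by lia.
have -> : (d < Ylow d b)%N = false by rewrite /Ylow; lia.
by rewrite iL; apply/eqP; f2 (g i d); f2 (g 0%N d).
Qed.

Lemma normalize_id g i j : (forall i j, tree_edge i j -> g i j = 0) ->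
  type_edge i j -> normalize g i j = g i j.
Proof.
move=> g0 /and4P[ij jd Lij ijb]; rewrite /normalize.
have pot0 m : (m <= minn d b)%N -> tree_potential g m = 0.
  move=> m_le; rewrite /tree_potential; case: eqP => // m0.
  case: ifP => mL; rewrite !g0 ?addr0 //; move: mL; rewrite /tree_edge /Ytop /Ylow; lia.
by rewrite !pot0 ?addr0 //; lia.
Qed.

(** The tree reaches every type, so killing it leaves no gauge freedom: types
    from [Ylow d b] on are joined to [0] directly, smaller ones through [d]. *)
Lemma tree_connected s : (forall i j, tree_edge i j -> s i = s j) ->
  forall i, (i <= Ytop d b)%N -> s i = s 0%N.
Proof.
move=> sT i i_le; case: (posnP i) => [-> //|i_gt0].
have [Li|iL] := leqP (Ylow d b) i.
  by rewrite -(sT 0%N i) // /tree_edge i_gt0 Li i_le.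
rewrite (sT i d) -?(sT 0%N d) //; move: iL i_gt0 i_le; rewrite /tree_edge /Ytop /Ylow; lia.
Qed.

(** A coboundary is determined by its values on a spanning tree. *)
Lemma normalize_coboundary g s : (forall i j, type_edge i j -> g i j = s i + s j) ->
  forall i j, type_edge i j -> normalize g i j = 0.
Proof.
move=> gs i j eij; rewrite /normalize.
have pot m : (m <= minn d b)%N -> tree_potential g m = s 0%N + s m.
  move=> m_le; rewrite /tree_potential; case: eqP => [->|m0].
    by rewrite F2_addxx.
  case: ifP => mL; last by apply: gs; rewrite /type_edge; lia.
  rewrite !gs; try by move: mL; rewrite /type_edge /Ylow; lia.
  by apply/eqP; f2 (s m); f2 (s 0%N); f2 (s d).
rewrite gs // !pot; try by move: eij; rewrite /type_edge; lia.
by apply/eqP; f2 (s i); f2 (s j); f2 (s 0%N).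
Qed.

(** The uniqueness half of the core: a cocycle zero on the tree and on all
    coordinate pairs is zero. *)
Section Vanishing.

Variable g : nat -> nat -> F2.
Hypotheses (g_coc : type_cocycle g)
  (g_tree : forall i j, tree_edge i j -> g i j = 0)
  (g_coord : forall i j, coord_edge i j -> g i j = 0).

(** An outer pair off the tree has [i + j >= b - 1], and its triangle with [0] has two
    tree edges. *)
Lemma cocycle_outer i j : type_edge i j ->
  [|| (i == 0)%N, j == d | (b <= (i + j).+1)%N] -> g i j = 0.
Proof.
move=> /and4P[ij jd Lij ijb] outer.
have [/g_tree //|not_tree] := boolP (tree_edge i j).
have face0 : type_face 0 i j.
  by move: not_tree outer ij jd Lij ijb; rewrite /tree_edge /type_face /Ytop /Ylow; lia.
have t0i : tree_edge 0 i.
  by move: not_tree outer ij jd Lij ijb; rewrite /tree_edge /Ytop /Ylow; lia.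
have t0j : tree_edge 0 j.
  by move: not_tree outer ij jd Lij ijb; rewrite /tree_edge /Ytop /Ylow; lia.
by rewrite -[LHS]add0r -{1}(g_tree t0i) -(g_coc face0) g_tree.
Qed.

(** The bound says [b - 2 - i - j < i], so an inner pair satisfying it is a coordinate
    pair. *)
Lemma cocycle_known i j : type_edge i j -> (b <= i + i + j + 1)%N -> g i j = 0.
Proof.
move=> eij known; case: (boolP [|| (i == 0)%N, j == d | (b <= (i + j).+1)%N]).
  exact: cocycle_outer.
move=> inner; apply: g_coord; move: eij inner known.
rewrite /type_edge /coord_edge; lia.
Qed.

(** The pairs with [j >= b - i - j] are the upper half of the path of [i].  Two
    consecutive triangles on the path, with [l = b - 1 - i - j], take [j] to [l] and
    [l] to [j + 1], so induction goes up to an outer pair or to a coordinate pair. *)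
Lemma cocycle_high i j : type_edge i j -> (b <= i + j + j)%N -> g i j = 0.
Proof.
have [n] := ubnP (d - j); elim: n j => // n IHn j lt_n eij high.
have [/(cocycle_outer eij)//|inner] :=
  boolP [|| (i == 0)%N, j == d | (b <= (i + j).+1)%N].
have [/(cocycle_known eij)//|free] := leqP b (i + i + j + 1).
have {}eij := and4P eij; case: eij => ij jd Lij ijb.
move: inner; rewrite !negb_or -ltnNge => /and3P[i0 jd' ijb'].
have Lb : (b <= d.+1 + Ylow d b)%N by rewrite /Ylow; lia.
pose l := (b - 1 - i - j)%N.
have face_j : type_face i l j by rewrite /type_face /l; lia.
have face_j1 : type_face i l j.+1 by rewrite /type_face /l; lia.
rewrite (g_coc face_j) [g l j]cocycle_known ?addr0; try by rewrite /type_edge /l; lia.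
have := g_coc face_j1; rewrite [g l j.+1]cocycle_known ?addr0; try by rewrite /type_edge /l; lia.
by move=> <-; apply: IHn; rewrite /type_edge; lia.
Qed.

(** A pair in the lower half of a path is joined to the upper half by the triangle of
    sum [b], unless its third type would be [d + 1]; then [i + j] is the least sum
    of an edge, and the triangle with [d] has its two other edges outer. *)
Lemma cocycle_eq0 i j : type_edge i j -> g i j = 0.
Proof.
move=> eij; have [/(cocycle_high eij)//|low] := leqP b (i + j + j).
have [/(cocycle_outer eij)//|inner] :=
  boolP [|| (i == 0)%N, j == d | (b <= (i + j).+1)%N].
have [/(cocycle_known eij)//|free] := leqP b (i + i + j + 1).
have {}eij := and4P eij; case: eij => ij jd Lij ijb.
move: inner; rewrite !negb_or -ltnNge => /and3P[i0 jd' ijb'].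
have Lb : (b <= d.+1 + Ylow d b)%N by rewrite /Ylow; lia.
have [l_le|l_gt] := leqP (b - i - j) d.
  have face_l : type_face i j (b - i - j) by rewrite /type_face; lia.
  have := g_coc face_l; rewrite cocycle_high; try by rewrite /type_edge; lia.
  by rewrite [g j _]cocycle_known ?addr0; try by rewrite /type_edge; lia.
have face_d : type_face i j d by rewrite /type_face; lia.
have := g_coc face_d; rewrite !(@cocycle_outer _ d) ?eqxx ?orbT ?addr0 //;
  rewrite /type_edge; lia.
Qed.

End Vanishing.

(** The existence half of the core: any values on the coordinate pairs extend to a
    cocycle that is zero on the tree. *)
Section Extension.

Variable phi : nat -> nat -> F2.
Hypothesis phi_supp : forall i j, ~~ coord_edge i j -> phi i j = 0.

(** On the path of [i], the values obtained by adding up the third edges of the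
    triangles between [i j] and the known pair: those of sum [b - 1] contribute
    [phi l (b - 1 - i - l)] and those of sum [b] contribute [phi l (b - i - l)], where [l]
    is the lower of the two types other than [i].  The lower half of the path has
    [j < b - i - j] and uses [l < j] and [l <= j]; the upper half uses [l < b - i - j] in
    both sums, whence the minima.  The term [l = i] of the first sum is the value
    at the coordinate pair [(i, b - 1 - 2 * i)] where the path starts.  If that pair has
    its second type at least [d], the known pair is [i d] instead, and the
    terms whose second argument is at least [d] are zero. *)
Definition extend_coord i j : F2 :=
  phi i j +
  if (i + i + j + 2 <= b)%N then
    \sum_(i <= l < minn j (b - i - j)) phi l (b - 1 - i - l)%N +
    \sum_(i.+1 <= l < minn j.+1 (b - i - j)) phi l (b - i - l)%N
  else 0.

Lemma extend_coord_id i j : coord_edge i j -> extend_coord i j = phi i j.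
Proof.
clear b_half phi_supp; rewrite /extend_coord /coord_edge => c.
by case: ifP => [|_]; [move: c; lia | rewrite addr0].
Qed.

Lemma extend_coord_tree i j : tree_edge i j -> extend_coord i j = 0.
Proof.
rewrite /extend_coord /tree_edge /Ytop => t; rewrite phi_supp ?add0r; last first.
  by move: t; rewrite /coord_edge /Ylow; lia.
case: ifP => // _; rewrite !big1_seq ?addr0 // => l; rewrite mem_index_iota => /andP[_ lr];
  by apply: phi_supp; move: t lr; rewrite /coord_edge /Ylow; lia.
Qed.

(** The third edge [j l] of a triangle is off the path, and [i j], [i l] are
    neighbors on the path of [i], so their partial sums differ by the one term
    [phi j l]. *)
Lemma extend_coord_cocycle : type_cocycle extend_coord.
Proof.
move=> i j l; rewrite /type_face => fijl.
have -> : extend_coord j l = phi j l.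
  by rewrite /extend_coord; case: ifP => [|_]; [move: fijl; lia | rewrite addr0].
rewrite /extend_coord.
have lt_ij : (i < j)%N by case/and4P: fijl.
have -> : (i + i + j + 2 <= b)%N by move: fijl; lia.
rewrite (phi_supp (i := i) (j := j)) ?add0r; last first.
  by move: fijl; rewrite /coord_edge; lia.
have [sum_b|sum_b] := eqVneq (i + j + l)%N b; last first.
  have -> : (i + i + l + 2 <= b)%N by move: fijl; lia.
  rewrite (phi_supp (i := i) (j := l)) ?add0r; last first.
    by move: fijl; rewrite /coord_edge; lia.
  have -> : minn l (b - i - l) = j.+1 by move: fijl; lia.
  have -> : minn l.+1 (b - i - l) = j.+1 by move: fijl; lia.
  have -> : minn j (b - i - j) = j by move: fijl; lia.
  have -> : minn j.+1 (b - i - j) = j.+1 by move: fijl; lia.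
  rewrite big_nat_recr 1?ltnW //= addrAC; congr (_ + phi j _).
  by move: fijl; lia.
have -> : minn j (b - i - j) = j by move: fijl; lia.
have -> : minn j.+1 (b - i - j) = j.+1 by move: fijl; lia.
rewrite (@big_nat_recr _ _ _ j) //=.
have -> : (b - i - j)%N = l by lia.
rewrite -[RHS]addrA -[X in _ = _ + X]addrA F2_addxx addr0.
(* For j = i + 1 the pair (i, l) is the coordinate end of the path. *)
have [lt_j|le_j] := ltnP i.+1 j; last first.
  have Ej : j = i.+1 by lia.
  rewrite ifF; last by lia.
  rewrite Ej big_nat1 big_geq // !addr0; congr (phi i _); lia.
have -> : (i + i + l + 2 <= b)%N by move: fijl; lia.
rewrite phi_supp ?add0r; last by move: fijl; rewrite /coord_edge; lia.
have -> : minn l (b - i - l) = j by move: fijl; lia.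
by have -> : minn l.+1 (b - i - l) = j by move: fijl; lia.
Qed.

End Extension.
End TypePairs.

(** * Coordinates on a quotient read off type pairs *)

Section Coordinates.

Variables d b : nat.
Implicit Types (x y : ctriple d b) (f : {ffun ctriple d b -> F2}).

Definition coord_i x : nat := (val x).1.2.
Definition coord_j x : nat := (val x).2.

Lemma coord_edgeT x : coord_edge d b (coord_i x) (coord_j x).
Proof.
case: x => -[[k i] j] /= t; move: (t); rewrite /coord_edge /is_ctriple /coord_i /coord_j /=.
lia.
Qed.

(** The smallest entry of a coordinate triple is determined by the two others. *)
Lemma coord_inj x y : coord_i x = coord_i y -> coord_j x = coord_j y -> x = y.
Proof.
case: x y => -[[k i] j] /= tx [[[k' i'] j'] /= ty] /=; rewrite /coord_i /coord_j /= => Ei Ej.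
apply/val_inj => /=; congr (_, _, _); apply/val_inj => //=.
by move: tx ty; rewrite /is_ctriple Ei Ej; lia.
Qed.

Lemma coord_edge_ctriple i j : coord_edge d b i j ->
  exists x, coord_i x = i /\ coord_j x = j.
Proof.
rewrite /coord_edge => c.
have t : @is_ctriple d b (inord (b - 2 - i - j), inord i, inord j).
  by rewrite /is_ctriple !inordK; move: c; lia.
exists (exist (fun p => is_ctriple b p) _ t); rewrite /coord_i /coord_j /= !inordK //;
  by move: c; lia.
Qed.

Definition spread_coord f i j : F2 :=
  \sum_(x | (coord_i x == i) && (coord_j x == j)) f x.

Lemma spread_coordK f x : spread_coord f (coord_i x) (coord_j x) = f x.
Proof.
rewrite /spread_coord (big_pred1 x) // => y /=.
by apply/andP/eqP=> [[/eqP Ei /eqP Ej]|-> //]; apply: coord_inj.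
Qed.

Lemma spread_coord_supp f i j : ~~ coord_edge d b i j -> spread_coord f i j = 0.
Proof.
move=> nc; rewrite /spread_coord big1 // => x /andP[/eqP Ei /eqP Ej].
by rewrite -Ei -Ej coord_edgeT in nc.
Qed.

(** In the applications [E] is the space of all voltages, or of all 1-cochains, and
    [rd u i j] is the value of [u] on edges with types [i < j]. *)
Variables (E : vectType 'F_2) (rd : E -> nat -> nat -> F2).
Hypothesis rd_linear : forall i j, linear (fun u => rd u i j).

Definition coord_reading (u : E) : {ffun ctriple d b -> F2} :=
  [ffun x => normalize d b (rd u) (coord_i x) (coord_j x)].

Lemma coord_reading_linear : linear coord_reading.
Proof.
move=> k u v; apply/ffunP=> x; rewrite !ffunE /normalize.
have rdE i j : rd (k *: u + v) i j = k *: rd u i j + rd v i j by apply: rd_linear.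
have potE i : tree_potential d b (rd (k *: u + v)) i =
    k *: tree_potential d b (rd u) i + tree_potential d b (rd v) i.
  rewrite /tree_potential; case: ifP => _; first by rewrite scaler0 addr0.
  by case: ifP => _; rewrite !rdE // scalerDr addrACA.
by rewrite rdE !potE !scalerDr [X in X + _ = _]addrACA [LHS]addrACA.
Qed.

HB.instance Definition _ := GRing.isLinear.Build _ _ _ _ coord_reading
  coord_reading_linear.

Variables U V : {vspace E}.
Hypotheses (b_half : (2 * b <= 3 * d + 1)%N) (sVU : (V <= U)%VS).
Hypothesis U_cocycle : forall u, u \in U -> type_cocycle d b (rd u).
Hypothesis U_onto : forall g, type_cocycle d b g -> exists2 u, u \in U &
  forall i j, type_edge d b i j -> rd u i j = g i j.
Hypothesis V_coboundary : forall u, u \in U -> reflect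
  (exists s : nat -> F2, forall i j, type_edge d b i j -> rd u i j = s i + s j)
  (u \in V).

Lemma coord_reading_eq0 u : u \in U -> (coord_reading u == 0) = (u \in V).
Proof.
move=> Uu; apply/eqP/V_coboundary => // [u0|[s rd_s]]; last first.
  apply/ffunP=> x; rewrite !ffunE (normalize_coboundary _ rd_s) //.
  exact/coord_edge_type/coord_edgeT.
exists (tree_potential d b (rd u)) => i j eij.
apply/F2_eq0; rewrite addrA -[LHS]/(normalize d b (rd u) i j).
apply: (@cocycle_eq0 d b); rewrite //.
- exact/cocycle_normalize/U_cocycle.
- exact: normalize_tree.
move=> {eij}i {}j /coord_edge_ctriple[x [<- <-]].
by have /ffunP/(_ x) := u0; rewrite !ffunE.
Qed.

Lemma coord_reading_onto f : exists2 u, u \in U & coord_reading u = f.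
Proof.
have supp := @spread_coord_supp f.
have [u Uu rd_u] := U_onto (extend_coord_cocycle b_half supp).
exists u => //; apply/ffunP=> x; rewrite ffunE.
have c := coord_edgeT x.
have edge_c := coord_edge_type c.
have tree0 i j : tree_edge d b i j -> rd u i j = 0.
  move=> t; rewrite rd_u ?(extend_coord_tree b_half supp t) //.
  exact: tree_edge_type t.
by rewrite normalize_id // rd_u // (extend_coord_id _ c) // spread_coordK.
Qed.

(** Reading the normalized values at the coordinate pairs kills exactly [V] in [U]
    and is onto, so it factors through an isomorphism of the quotient. *)
Theorem quotient_coordinates :
  exists phi : 'Hom(subvs_of (quotv U V), {ffun ctriple d b -> F2}),
    bijective phi /\ {in U, forall u, phi (quot_class U V u) = coord_reading u}.
Proof.
have rV v : v \in V -> coord_reading v = 0.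
  by move=> Vv; apply/eqP; rewrite coord_reading_eq0 // (subvP sVU).
pose r : 'Hom(E, {ffun ctriple d b -> F2}) := linfun coord_reading.
pose phi := (r \o linfun (@vsval _ _ (quotv U V)))%VF.
have phiE u : u \in U -> phi (quot_class U V u) = coord_reading u.
  move=> Uu; rewrite comp_lfunE !lfunE /= vsprojK ?memv_img //.
  by rewrite add_lfunE opp_lfunE id_lfunE linearB /= (rV (projv V u)) ?memv_proj ?subr0.
exists phi; split=> //.
have phi_inj : lker phi == 0%VS.
  rewrite -subv0; apply/subvP=> q; have [u Uu <-] := quot_class_onto q.
  rewrite memv_ker phiE // coord_reading_eq0 // memv0 => Vu.
  have -> : 0 = quot_class U V 0 by rewrite /quot_class !linear0.
  by rewrite quot_class_eq ?mem0v ?subr0.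
have phi_onto f : exists q, phi q = f.
  by have [u Uu <-] := coord_reading_onto f; exists (quot_class U V u); apply: phiE.
exists (phi^-1)%VF; first exact: lker0_lfunK.
move=> f; have [q <-] := phi_onto f; by rewrite lker0_lfunK.
Qed.

Corollary dim_quotient_coordinates : \dim (quotv U V) = #|{: ctriple d b}|.
Proof.
have rV : (U :&: lker (linfun coord_reading))%VS = V.
  apply/vspaceP=> u; rewrite memv_cap memv_ker lfunE /=.
  have [Uu|nUu] := boolP (u \in U); first by rewrite coord_reading_eq0.
  by apply/esym/(contraNF _ nUu) => /(subvP sVU).
rewrite dim_quotv // -(limg_ker_dim (linfun coord_reading) U) rV addKn.
have -> : (linfun coord_reading @: U)%VS = fullv.
  apply/vspaceP=> f; rewrite memvf; have [u Uu <-] := coord_reading_onto f.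
  by rewrite -(lfunE coord_reading) memv_img.
by rewrite dimvf /dim /= muln1.
Qed.

End Coordinates.

(** * Unordered pairs of indices *)

Lemma big_set3 (R : Type) (idx : R) (op : Monoid.com_law idx) (I : finType)
    (i j l : I) (F : I -> R) : i != j -> i != l -> j != l ->
  \big[op/idx]_(x in [set i; j; l]) F x = op (op (F i) (F j)) (F l).
Proof.
move=> ij il jl; rewrite setUC big_setU1 ?big_setU1 ?big_set1 ?inE //.
  by rewrite Monoid.mulmC.
by rewrite negb_or eq_sym il eq_sym jl.
Qed.

Lemma sorted_pair_inj n (i j a c : 'I_n) : (i < j)%N -> (a < c)%N ->
  [set i; j] = [set a; c] -> i = a /\ j = c.
Proof.
move=> ij ac E; have := set21 i j; have := set22 i j; have := set21 a c.
rewrite -{1}E E => /set2P aE /set2P jE /set2P iE.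
case: iE jE aE ij ac => -> [->|->] // [?|?]; subst; lia.
Qed.

Section PairValue.

Variable n : nat.
Implicit Types (g : nat -> nat -> F2) (i j l : 'I_n).

(** Only the increasing enumeration of a two-element set contributes to the sum. *)
Definition pair_value g (X : {set 'I_n}) : F2 :=
  \sum_(p : 'I_n * 'I_n | (p.1 < p.2)%N && (X == [set p.1; p.2])) g p.1 p.2.

Lemma pair_value_lt g i j : (i < j)%N -> pair_value g [set i; j] = g i j.
Proof.
move=> ij; rewrite /pair_value (big_pred1 (i, j)) // => -[a c] /=.
apply/andP/eqP=> [[ac /eqP E]|[-> ->]]; last by rewrite ij.
by have [-> ->] := sorted_pair_inj ij ac E.
Qed.

Lemma pair_value_diag g i : pair_value g [set i; i] = 0.
Proof.
rewrite /pair_value big_pred0 // => -[a c] /=; apply/negbTE/negP => /andP[ac /eqP E].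
have := set21 a c; have := set22 a c; rewrite -E => /set2P cE /set2P aE.
by case: cE aE ac => -> [->|->]; rewrite ltnn.
Qed.

(** A cocycle condition on increasing triples is one on all triples, degenerate
    ones included, once the values are read symmetrically and vanish on the
    diagonal. *)
Lemma pair_value_cocycle d b g i j l : type_cocycle d b g -> (i <= d)%N -> (j <= d)%N ->
  (l <= d)%N -> ((i + j + l).+1 == b) || (i + j + l == b)%N ->
  pair_value g [set i; l] = pair_value g [set i; j] + pair_value g [set j; l].
Proof.
move=> cg id jd ld sum_b.
have face a c e : (a < c)%N -> (c < e)%N -> (e <= d)%N ->
    (a + c + e = i + j + l)%N -> g a e = g a c + g c e.
  by move=> ac ce ed E; apply: cg; rewrite /type_face ac ce ed E.
case: (ltngtP i j) => [ij|ji|/val_inj->]; last by rewrite pair_value_diag add0r.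
- case: (ltngtP j l) => [jl|lj|/val_inj<-]; last by rewrite pair_value_diag addr0.
  + rewrite !pair_value_lt //; [exact: face | exact: ltn_trans jl].
  + rewrite (setUC [set j]); case: (ltngtP i l) => [il|li|/val_inj<-].
    * rewrite !pair_value_lt // (face i l j) //; last lia.
      by apply/eqP; f2 (g i l); f2 (g l j).
    * rewrite (setUC [set i] [set l]) !pair_value_lt // (face l i j) //; last lia.
      by apply/eqP; f2 (g l i); f2 (g i j).
    * by rewrite pair_value_diag F2_addxx.
- rewrite (setUC [set i] [set j]).
  case: (ltngtP j l) => [jl|lj|/val_inj<-].
  + case: (ltngtP i l) => [il|li|/val_inj<-].
    * rewrite !pair_value_lt // (face j i l) //; last lia.
      by apply/eqP; f2 (g j i); f2 (g i l).
    * rewrite (setUC [set i] [set l]) !pair_value_lt // (face j l i) //; last lia.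
      by apply/eqP; f2 (g j l); f2 (g l i).
    * by rewrite pair_value_diag F2_addxx.
  + rewrite (setUC [set i] [set l]) (setUC [set j] [set l]).
    rewrite !pair_value_lt // ?(ltn_trans lj) // (face l j i) //; last lia.
    by rewrite addrC.
  + by rewrite pair_value_diag addr0 setUC.
Qed.

End PairValue.

Lemma sorted_pair n (X : {set 'I_n}) : #|X| = 2%N ->
  exists i j : 'I_n, (i < j)%N /\ X = [set i; j].
Proof.
move/eqP/cards2P=> [i [j [ij ->]]].
case: (ltngtP i j) => [lt|lt|/val_inj E]; last by rewrite E eqxx in ij.
  by exists i, j.
by exists j, i; rewrite setUC.
Qed.

Lemma sorted_triple n (X : {set 'I_n}) : #|X| = 3%N ->
  exists i j l : 'I_n, [/\ (i < j)%N, (j < l)%N & X = [set i; j; l]].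
Proof.
move=> cX; have [x Xx] : exists x, x \in X by apply/card_gt0P; rewrite cX.
have cX' : #|X :\ x| = 2%N by move: cX; rewrite (cardsD1 x) Xx => -[].
have [i [j [ij E]]] := sorted_pair cX'.
have -> : X = [set x; i; j] by rewrite -setUA -E setD1K.
have xi : i != x by move: (set21 i j); rewrite -E inE => /andP[]; rewrite inE.
have xj : j != x by move: (set22 i j); rewrite -E inE => /andP[]; rewrite inE.
case: (ltngtP x i) => [lt_xi|lt_ix|/val_inj Exi]; last by rewrite Exi eqxx in xi.
  by exists x, i, j.
case: (ltngtP x j) => [lt_xj|lt_jx|/val_inj Exj]; last by rewrite Exj eqxx in xj.
  by exists i, x, j; split=> //; rewrite (setUC [set x]).
by exists i, j, x; split=> //; rewrite -setUA setUC.
Qed.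

(** * Cohomology of the type complex *)

Section CochainValues.

Variables (V : finType) (Y : {set {set V}}) (k : nat).
Implicit Types (f : cochain Y k) (X : {set V}).

(** Extending a cochain by zero to all sets turns sums over the facets of a simplex
    into sums over its vertices. *)
Definition cochain_at f X : F2 := \sum_(t : simplex Y k | val t == X) f t.

Lemma cochain_atE f (t : simplex Y k) : cochain_at f (val t) = f t.
Proof. by rewrite /cochain_at (big_pred1 t) // => u; rewrite /= (inj_eq val_inj). Qed.

Lemma cochain_at_linear X : linear (cochain_at^~ X).
Proof.
move=> c f g; rewrite /cochain_at scaler_sumr -big_split /=.
by apply: eq_bigr => t _; rewrite !ffunE.
Qed.

Lemma cochain_diffE f (s : simplex Y k.+1) :
  cochain_diff f s = \sum_(x in val s) cochain_at f (val s :\ x).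
Proof.
rewrite ffunE /cochain_at (exchange_big_dep (fun t : simplex Y k => val t \subset val s)) /=;
  last by move=> x t _ /eqP->; apply: subsetDl.
apply: eq_bigr => t ts.
have /andP[_ /eqP ct] := valP t; have /andP[_ /eqP cs] := valP s.
have /eqP/cards1P[y Ey] : #|val s :\: val t| = 1%N.
  by rewrite cardsD (setIidPr ts) ct cs subSnn.
have := set11 y; rewrite -Ey inE => /andP[yt ys].
rewrite (big_pred1 y) // => x /=; apply/andP/eqP=> [[xs /eqP E]|->].
  by apply/set1P; rewrite -Ey inE xs (E : val t = _) !inE eqxx.
split=> //; rewrite eqEcard subsetD1 ts yt /= ct.
by move: cs; rewrite (cardsD1 y) ys => -[] /eq_leq; rewrite add0n => ->.
Qed.

End CochainValues.

Lemma exists_simplex (V : finType) (Y : {set {set V}}) k X :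
  X \in Y -> #|X| = k.+1 -> exists t : simplex Y k, val t = X.
Proof.
move=> XY cX; have tP : (X \in Y) && (#|X| == k.+1) by rewrite XY cX eqxx.
by exists (exist (fun X => (X \in Y) && (#|X| == k.+1)) X tP).
Qed.

Section TypeComplexCohomology.

Variables d b : nat.
Hypothesis b_half : (2 * b <= 3 * d + 1)%N.

Local Notation Y := (type_complex d b).
Local Notation vert := 'I_(Ytop d b).+1.

Definition cochain_reading (c : cochain Y 1) i j : F2 :=
  cochain_at c [set inord i; inord j].

Lemma cochain_readingE c (i j : vert) : cochain_reading c i j = cochain_at c [set i; j].
Proof. by rewrite /cochain_reading !inord_val. Qed.

Lemma type_edge_simplex (i j : vert) : (i < j)%N ->
  ([set i; j] \in Y) = type_edge d b i j.
Proof.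
move=> ij; have neq : i != j by rewrite neq_ltn ij.
have jd : (j <= d)%N by rewrite (leq_trans _ (geq_minl d b)) // -ltnS.
by rewrite inE cards2 neq /= big_setU1 ?inE // big_set1 /= orbF /type_edge ij jd.
Qed.

Lemma cards_triple (i j l : vert) : (i < j)%N -> (j < l)%N -> #|[set i; j; l]| = 3%N.
Proof.
move=> ij jl; have il := ltn_trans ij jl.
rewrite setUC cardsU1 cards2 !inE !neq_ltn ij /= negb_or.
by rewrite !neq_ltn il jl !orbT.
Qed.

Lemma type_face_simplex (i j l : vert) : (i < j)%N -> (j < l)%N ->
  ([set i; j; l] \in Y) = type_face d b i j l.
Proof.
move=> ij jl; have il := ltn_trans ij jl.
have [nij nil njl] : [/\ i != j, i != l & j != l] by rewrite !neq_ltn ij jl il.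
have ld : (l <= d)%N by rewrite (leq_trans _ (geq_minl d b)) // -ltnS.
by rewrite inE cards_triple //= big_set3 //= /type_face ij jl ld.
Qed.

Lemma simplex1P (t : simplex Y 1) :
  exists i j : vert, [/\ (i < j)%N, val t = [set i; j] & type_edge d b i j].
Proof.
have /andP[tY /eqP ct] := valP t; have [i [j [ij E]]] := sorted_pair ct.
by exists i, j; rewrite -type_edge_simplex // -E.
Qed.

Lemma simplex2P (s : simplex Y 2) : exists i j l : vert,
  [/\ (i < j)%N, (j < l)%N, val s = [set i; j; l] & type_face d b i j l].
Proof.
have /andP[sY /eqP cs] := valP s; have [i [j [l [ij jl E]]]] := sorted_triple cs.
by exists i, j, l; rewrite -type_face_simplex // -E.
Qed.

Lemma cochain_diff1E c (s : simplex Y 2) (i j l : vert) :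
    (i < j)%N -> (j < l)%N -> val s = [set i; j; l] ->
  cochain_diff c s = cochain_reading c i j + cochain_reading c i l + cochain_reading c j l.
Proof.
move=> ij jl E; have il := ltn_trans ij jl.
have [nij nil njl] : [/\ i != j, i != l & j != l] by rewrite !neq_ltn ij jl il.
rewrite cochain_diffE E big_set3 // !cochain_readingE.
have -> : [set i; j; l] :\ i = [set j; l].
  apply/setP=> x; rewrite !inE; case: eqP => //= ->.
  by rewrite (negbTE nij) (negbTE nil).
have -> : [set i; j; l] :\ j = [set i; l].
  apply/setP=> x; rewrite !inE; case: (x =P j) => /= [->|_]; last by rewrite orbF.
  by rewrite eq_sym (negbTE nij) (negbTE njl).
have -> : [set i; j; l] :\ l = [set i; j].
  apply/setP=> x; rewrite !inE; case: (x =P l) => //= [->|_].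
    by rewrite eq_sym (negbTE nil) eq_sym (negbTE njl).
  by rewrite orbF.
by rewrite addrC addrA addrAC.
Qed.

Lemma cochain_kerP c :
  reflect (type_cocycle d b (cochain_reading c)) (c \in lker (linfun (@cochain_diff _ Y 1))).
Proof.
rewrite memv_ker lfunE /=; apply: (iffP eqP) => [c0 i j l f|coc].
  have [ij jl ld sum_b] := and4P f.
  have bnd m : (m <= l)%N -> (m < (Ytop d b).+1)%N by rewrite /Ytop; lia.
  pose i' : vert := inord i; pose j' : vert := inord j; pose l' : vert := inord l.
  have Ei : i' = i :> nat by rewrite inordK // bnd //; lia.
  have Ej : j' = j :> nat by rewrite inordK // bnd //; lia.
  have El : l' = l :> nat by rewrite inordK // bnd //; lia.
  have [s Es] : exists s : simplex Y 2, val s = [set i'; j'; l'].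
    by apply: exists_simplex; rewrite ?type_face_simplex ?cards_triple ?Ei ?Ej ?El.
  have /ffunP/(_ s) := c0.
  rewrite [in RHS]ffunE (@cochain_diff1E _ _ i' j' l') ?Ei ?Ej ?El //.
  by rewrite addrAC => /F2_eq0/esym.
apply/ffunP=> s; rewrite [in RHS]ffunE; have [i [j [l [ij jl E f]]]] := simplex2P s.
by rewrite (cochain_diff1E _ ij jl E) (coc _ _ _ f) addrAC F2_addxx.
Qed.

Lemma cochain_reading_onto g : type_cocycle d b g ->
  exists2 c, c \in lker (linfun (@cochain_diff _ Y 1))
    & forall i j, type_edge d b i j -> cochain_reading c i j = g i j.
Proof.
move=> coc; pose c : cochain Y 1 := [ffun t => pair_value g (val t)].
have cE i j : type_edge d b i j -> cochain_reading c i j = g i j.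
  move=> e; have [ij jd Lij ijb] := and4P e.
  pose i' : vert := inord i; pose j' : vert := inord j.
  have Ei : i' = i :> nat by rewrite inordK // /Ytop; lia.
  have Ej : j' = j :> nat by rewrite inordK // /Ytop; lia.
  have nij : i' != j' by rewrite -val_eqE /= Ei Ej neq_ltn ij.
  have [t Et] : exists t : simplex Y 1, val t = [set i'; j'].
    by apply: exists_simplex; rewrite ?type_edge_simplex ?cards2 ?nij ?Ei ?Ej.
  rewrite /cochain_reading -/i' -/j' -Et cochain_atE ffunE Et.
  by rewrite pair_value_lt ?Ei ?Ej.
exists c => //; apply/cochain_kerP=> i j l f; rewrite !cE; first exact: coc.
all: by move: f; rewrite /type_face /type_edge /Ylow; lia.
Qed.

Lemma cochain_diff0_reading (f : cochain Y 0) i j : type_edge d b i j ->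
  cochain_reading (cochain_diff f) i j =
  cochain_at f [set inord i] + cochain_at f [set inord j].
Proof.
move=> e; have [ij jd Lij ijb] := and4P e.
pose i' : vert := inord i; pose j' : vert := inord j.
have Ei : i' = i :> nat by rewrite inordK // /Ytop; lia.
have Ej : j' = j :> nat by rewrite inordK // /Ytop; lia.
have nij : i' != j' by rewrite -val_eqE /= Ei Ej neq_ltn ij.
have [t Et] : exists t : simplex Y 1, val t = [set i'; j'].
  by apply: exists_simplex; rewrite ?type_edge_simplex ?cards2 ?nij ?Ei ?Ej.
rewrite /cochain_reading -/i' -/j' -Et cochain_atE cochain_diffE Et.
rewrite big_setU1 ?inE // big_set1 [LHS]addrC; congr (cochain_at f _ + cochain_at f _).
  by rewrite setUC setU1K // inE eq_sym.
by rewrite setU1K ?inE.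
Qed.

Lemma cochain_imgP c : reflect
  (exists s : nat -> F2, forall i j, type_edge d b i j -> cochain_reading c i j = s i + s j)
  (c \in limg (linfun (@cochain_diff _ Y 0))).
Proof.
apply: (iffP memv_imgP) => [[f _ ->]|[s cs]].
  exists (fun i => cochain_at f [set inord i]) => i j e.
  by rewrite lfunE cochain_diff0_reading.
pose f : cochain Y 0 := [ffun t : simplex Y 0 => \sum_(x in val t) s (x : vert) : F2].
exists f; rewrite ?memvf // lfunE /=; apply/ffunP=> t.
have [i [j [ij E e]]] := simplex1P t.
have fE (x : vert) : cochain_at f [set x] = s x.
  have [t' Et'] : exists t' : simplex Y 0, val t' = [set x].
    by apply: exists_simplex; rewrite ?inE cards1.
  by rewrite -Et' cochain_atE ffunE Et' big_set1.
have := cochain_diff0_reading f e; rewrite !inord_val !fE -cs // !cochain_readingE -E.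
by rewrite !cochain_atE => ->.
Qed.

Lemma cochain_img_sub_ker :
  (limg (linfun (@cochain_diff _ Y 0)) <= lker (linfun (@cochain_diff _ Y 1)))%VS.
Proof.
apply/subvP=> c /cochain_imgP[s cs]; apply/cochain_kerP=> i j l f.
rewrite !cs; first by apply/eqP; f2 (s i); f2 (s j); f2 (s l).
all: by move: f; rewrite /type_face /type_edge /Ylow; lia.
Qed.

(** [H1] is the quotient of the cocycles by the coboundaries of the type complex, and
    its cochains are read on type pairs without loss. *)
Lemma dim_H1_type_complex : \dim (H1 Y) = #|{: ctriple d b}|.
Proof.
apply: (dim_quotient_coordinates (rd := cochain_reading)) => //.
- by move=> i j; apply: cochain_at_linear.
- exact: cochain_img_sub_ker.
- by move=> c /cochain_kerP.
- exact: cochain_reading_onto.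
- by move=> c _; apply: cochain_imgP.
Qed.

End TypeComplexCohomology.

(** * Vertices, edges and triangles of the Kneser graph *)

Lemma exists_subset (T : finType) (P : {set T}) n : (n <= #|P|)%N ->
  exists2 X : {set T}, X \subset P & #|X| = n.
Proof.
move=> le_n; exists [set x in take n (enum P)].
  by apply/subsetP=> x; rewrite inE => /mem_take; rewrite mem_enum.
rewrite cardsE (card_uniqP _) ?take_uniq ?enum_uniq // size_takel //.
by rewrite -cardE.
Qed.

Lemma leq_disjoint3 (T : finType) (S1 S2 S3 X : {set T}) :
  [disjoint S1 & S2] -> [disjoint S1 & S3] -> [disjoint S2 & S3] ->
  (#|S1 :&: X| + #|S2 :&: X| + #|S3 :&: X| <= #|X|)%N.
Proof.
rewrite -!setI_eq0 => /eqP d12 /eqP d13 /eqP d23.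
have cardU (P Q : {set T}) : P :&: Q = set0 ->
    (#|P :&: X| + #|Q :&: X| = #|(P :|: Q) :&: X|)%N.
  by move=> PQ; rewrite setIUl cardsU -setIIl PQ set0I cards0 subn0.
rewrite !cardU ?subset_leq_card ?subsetIr //.
by rewrite setIUl d13 d23 setU0.
Qed.

Section Kneser.

Variables (Omega : finType) (d : nat) (B : {set Omega}).
Local Notation b := #|B|.
Local Notation vertex := (@kvertex Omega d).
Local Notation edge := (edge (@kadj Omega d)).
Local Notation voltage := (voltage (@kadj Omega d)).
Local Notation type := (ktype B).

Implicit Types (S T W : vertex) (alpha : voltage) (e : edge) (i j : 'I_d.+1).

Lemma card_outside S : #|val S :&: ~: B| = (d - type S)%N.
Proof.
by have := cardsID B (val S); rewrite (eqP (valP S)) -setDE /=; lia.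
Qed.

(** The last two counts allow disjoint vertices to be picked one after another. *)
Lemma exists_vertex (P : {set Omega}) i : (i <= #|P :&: B|)%N -> (d - i <= #|P :\: B|)%N ->
  exists S, [/\ type S = i, val S \subset P,
    #|(P :\: val S) :&: B| = (#|P :&: B| - i)%N
    & #|(P :\: val S) :\: B| = (#|P :\: B| - (d - i))%N].
Proof.
move=> /exists_subset[X XP cX] /exists_subset[Y YP cY].
have XB x : x \in X -> x \in B by move/(subsetP XP); rewrite inE => /andP[].
have YB x : x \in Y -> x \notin B by move/(subsetP YP); rewrite inE => /andP[].
have SB : (X :|: Y) :&: B = X.
  apply/setP=> x; rewrite !inE.
  by case: (boolP (x \in X)) => [/XB->//|_]; case: (boolP (x \in Y)) => // /YB/negbTE->.
have SD : (X :|: Y) :\: B = Y.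
  apply/setP=> x; rewrite !inE.
  case: (boolP (x \in Y)) => [/YB->|_]; first by rewrite orbT.
  by case: (boolP (x \in X)) => [/XB->|_]; rewrite ?andbF.
have cS : #|X :|: Y| == d by rewrite -(cardsID B) SB SD cX cY subnKC // -ltnS.
exists (exist (fun S : {set Omega} => #|S| == d) _ cS); split=> /=.
- by apply/val_inj; rewrite /= SB.
- rewrite subUset (subset_trans XP) ?subsetIl // (subset_trans YP) ?subsetDl //.
- have -> : (P :\: (X :|: Y)) :&: B = (P :&: B) :\: X.
    by rewrite -{2}SB; apply/setP=> x; rewrite !inE; case: (x \in B); rewrite ?(andbT, andbF).
  by rewrite cardsD (setIidPr XP) cX.
- have -> : (P :\: (X :|: Y)) :\: B = (P :\: B) :\: Y.
    by rewrite -{2}SD; apply/setP=> x; rewrite !inE; case: (x \in B); rewrite ?(andbT, andbF).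
  by rewrite cardsD (setIidPr YP) cY.
Qed.

Hypotheses (d_gt0 : (0 < d)%N) (card_Omega : #|Omega| = (3 * d + 1)%N)
  (b_half : (2 * #|B| <= 3 * d + 1)%N).

Let adjP S T : reflect (exists e : edge, val e = [set S; T]) (kadj S T) :=
  edgeP (@kadj_sym Omega d) (kadj_irr d_gt0) S T.

Lemma card_compl_block : #|~: B| = (3 * d + 1 - b)%N.
Proof. by rewrite -card_Omega -(cardsC B) addKn. Qed.

(** The two bounds come from counting inside and outside [B]. *)
Lemma types_adj S T : kadj S T ->
  (Ylow d b <= type S + type T)%N && (type S + type T <= b)%N.
Proof.
move=> ST; have dis0 (P : {set Omega}) : [disjoint P & set0] by rewrite -setI_eq0 setI0.
have le3 X := leq_disjoint3 X ST (dis0 _) (dis0 _).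
move: (le3 B) (le3 (~: B)); rewrite !card_outside !set0I !cards0 card_compl_block /Ylow /=.
by have /= := ltn_ord (type S); have /= := ltn_ord (type T); lia.
Qed.

(** A triangle covers all but one of the points, so its types sum to [b] or, when
    the missing point is in [B], to [b - 1]. *)
Lemma types_triangle S T W : kadj S T -> kadj S W -> kadj T W ->
  ((type S + type T + type W).+1 == b) || (type S + type T + type W == b)%N.
Proof.
move=> ST SW TW; have le3 X := leq_disjoint3 X ST SW TW.
move: (le3 B) (le3 (~: B)); rewrite !card_outside card_compl_block /=.
have /= := ltn_ord (type S); have /= := ltn_ord (type T); have /= := ltn_ord (type W); lia.
Qed.

Lemma exists_edge i j : (Ylow d b <= i + j <= b)%N ->
  exists S T, [/\ kadj S T, type S = i & type T = j].
Proof.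
have := ltn_ord i; have := ltn_ord j; rewrite /Ylow => jd id ij.
have cB : #|[set: Omega] :&: B| = b by rewrite setTI.
have cD : #|[set: Omega] :\: B| = (3 * d + 1 - b)%N by rewrite setTD card_compl_block.
have [||S [tS _ SB SD]] := @exists_vertex setT i; rewrite ?cB ?cD; try lia.
have [||T [tT TS _ _]] := @exists_vertex (setT :\: val S) j; rewrite ?SB ?SD ?cB ?cD; try lia.
by exists S, T; split=> //; rewrite /kadj disjoint_sym disjoints_subset -setTD.
Qed.

Lemma exists_triangle (i j l : 'I_d.+1) : type_face d b i j l ->
  exists S T W, [/\ kadj S T, kadj S W & kadj T W] /\ [/\ type S = i, type T = j & type W = l].
Proof.
rewrite /type_face => f; have := ltn_ord l.
have cB : #|[set: Omega] :&: B| = b by rewrite setTI.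
have cD : #|[set: Omega] :\: B| = (3 * d + 1 - b)%N by rewrite setTD card_compl_block.
move=> ld.
have [||S [tS _ SB SD]] := @exists_vertex setT i; rewrite ?cB ?cD; try lia.
have [||T [tT TS TB TD]] := @exists_vertex (setT :\: val S) j;
  rewrite ?SB ?SD ?cB ?cD; try lia.
have [||W [tW WT _ _]] := @exists_vertex (setT :\: val S :\: val T) l;
  rewrite ?TB ?TD ?SB ?SD ?cB ?cD; try lia.
exists S, T, W; rewrite /kadj; split=> //; split.
- by rewrite disjoint_sym disjoints_subset -setTD.
- by rewrite disjoint_sym disjoints_subset -setTD (subset_trans WT) ?subsetDl.
- rewrite disjoint_sym disjoints_subset -setTD (subset_trans WT) ?setSD ?subsetT //.
Qed.

(** * Reading voltages by types *)

Lemma edge_ends e : exists S T, val e = [set S; T] /\ kadj S T.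
Proof.
have /existsP[S /existsP[T /andP[ST /eqP Ee]]] := valP e.
by exists S, T.
Qed.

Lemma edge_typesE e S T : val e = [set S; T] -> edge_types B e = [set type S; type T].
Proof. by rewrite /edge_types => ->; rewrite imsetU1 imset_set1. Qed.

Lemma exists_typed_edge (i j : nat) : type_edge d b i j ->
  exists (e : edge) (i' j' : 'I_d.+1),
    [/\ i' = i :> nat, j' = j :> nat & edge_types B e = [set i'; j']].
Proof.
move=> /and4P[ij jd Lij ijb].
have Ei : (inord i : 'I_d.+1) = i :> nat by rewrite inordK //; lia.
have Ej : (inord j : 'I_d.+1) = j :> nat by rewrite inordK //; lia.
have [|S [T [/adjP[e Ee] tS tT]]] := @exists_edge (inord i) (inord j).
  by rewrite Ei Ej Lij.
by exists e, (inord i), (inord j); rewrite (edge_typesE Ee) tS tT.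
Qed.

Lemma type_coboundary_types (s : 'I_d.+1 -> F2) e i j : (i < j)%N ->
  edge_types B e = [set i; j] -> type_coboundary B s e = s i + s j.
Proof.
move=> ij; have [S [T [Ee ST]]] := edge_ends e.
rewrite (edge_typesE Ee) (type_coboundaryE _ _ _ Ee) // => E.
case: (ltngtP (type S) (type T)) => [lt|gt|/val_inj eq].
- by have [-> ->] := sorted_pair_inj lt ij E.
- by rewrite setUC in E; have [-> ->] := sorted_pair_inj gt ij E; apply: addrC.
have := set21 i j; have := set22 i j; rewrite -E eq setUid => /set1P Ej /set1P Ei.
by rewrite Ei Ej ltnn in ij.
Qed.

(** For a type-invariant voltage the choice of the edge is immaterial; pairs of
    types that occur on no edge are read as zero. *)
Definition voltage_reading alpha (i j : nat) : F2 :=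
  if [pick e : edge | edge_types B e == [set inord i; inord j]] is Some e
  then alpha e else 0.

Lemma voltage_reading_linear (i j : nat) : linear (fun alpha => voltage_reading alpha i j).
Proof.
move=> c f g; rewrite /voltage_reading; case: pickP => [e _|_]; first by rewrite !ffunE.
by rewrite scaler0 addr0.
Qed.

Lemma voltage_readingE alpha e i j : type_invariant B alpha ->
  edge_types B e = [set i; j] -> alpha e = voltage_reading alpha i j.
Proof.
move=> /forallP inv Ee; rewrite /voltage_reading !inord_val.
case: pickP => [e' /eqP Ee'|/(_ e)]; last by rewrite Ee eqxx.
by apply/eqP; have /forallP/(_ e')/implyP := inv e; apply; rewrite Ee Ee'.
Qed.

Lemma voltage_reading_adj alpha e S T : type_invariant B alpha ->
  val e = [set S; T] -> alpha e = voltage_reading alpha (type S) (type T).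
Proof. by move=> inv /edge_typesE; apply: voltage_readingE. Qed.

(** Preserving neighborhoods is summing to zero on triangles, and every type triple
    of sum [b - 1] or [b] occurs on a triangle. *)
Lemma admissible_cocycle alpha : admissible B alpha ->
  type_cocycle d b (voltage_reading alpha).
Proof.
case/and3P=> _ inv /(preserves_nbhdsP (@kadj_sym _ _) (kadj_irr d_gt0)) tri i j l f.
have [ij jl ld _] := and4P f.
have Ei : (inord i : 'I_d.+1) = i :> nat by rewrite inordK //; lia.
have Ej : (inord j : 'I_d.+1) = j :> nat by rewrite inordK //; lia.
have El : (inord l : 'I_d.+1) = l :> nat by rewrite inordK //; lia.
have [|S [T [W [[ST SW TW] [tS tT tW]]]]] := @exists_triangle (inord i) (inord j) (inord l).
  by rewrite Ei Ej El.
have /adjP[e1 E1] := ST; have /adjP[e2 E2] := SW; have /adjP[e3 E3] := TW.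
have := tri _ _ _ _ _ _ E1 E3 E2.
rewrite (voltage_reading_adj inv E1) (voltage_reading_adj inv E2).
by rewrite (voltage_reading_adj inv E3) tS tT tW Ei Ej El.
Qed.

Lemma admissible_onto g : type_cocycle d b g ->
  exists2 alpha, admissible B alpha
    & forall i j : nat, type_edge d b i j -> voltage_reading alpha i j = g i j.
Proof.
move=> coc; pose alpha : voltage := [ffun e => pair_value g (edge_types B e)].
have inv : type_invariant B alpha.
  by apply/forallP=> e; apply/forallP=> e'; apply/implyP=> /eqP E; rewrite !ffunE E.
exists alpha => [|i j eij].
  apply/and3P; split=> //.
    apply/forall_inP=> e /forall_inP same; have [S [T [Ee ST]]] := edge_ends e.
    have := same S; rewrite Ee set21 => /(_ isT)/forall_inP/(_ T).
    by rewrite set22 => /(_ isT)/eqP tST; rewrite ffunE (edge_typesE Ee) tST pair_value_diag.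
  apply/(preserves_nbhdsP (@kadj_sym _ _) (kadj_irr d_gt0)) => x y z exy eyz exz Exy Eyz Exz.
  rewrite !ffunE (edge_typesE Exy) (edge_typesE Eyz) (edge_typesE Exz).
  apply: (pair_value_cocycle coc); rewrite -1?ltnS //.
  by apply: types_triangle; apply/adjP; [exists exy | exists exz | exists eyz].
have [e [i' [j' [Ei Ej Ee]]]] := exists_typed_edge eij.
have := voltage_readingE inv Ee; rewrite Ei Ej => <-.
by rewrite ffunE Ee pair_value_lt Ei Ej //; case/and4P: eij.
Qed.

(** Looplessness covers the edges whose ends have the same type. *)
Lemma gaugeP alpha : admissible B alpha -> reflect
  (exists s : nat -> F2,
    forall i j : nat, type_edge d b i j -> voltage_reading alpha i j = s i + s j)
  (is_type_coboundary B alpha).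
Proof.
case/and3P=> loop inv _; apply: (iffP existsP) => [[s /eqP as_]|[s rd_s]].
  exists (fun k : nat => s (inord k)) => i j eij.
  have [e [i' [j' [Ei Ej Ee]]]] := exists_typed_edge eij.
  have := voltage_readingE inv Ee; rewrite Ei Ej => <-.
  rewrite as_ (type_coboundary_types _ _ Ee) -?Ei -?Ej ?inord_val //.
  by rewrite Ei Ej; case/and4P: eij.
exists [ffun i : 'I_d.+1 => s i : 'F_2]; apply/eqP/ffunP=> e.
have [S [T [Ee ST]]] := edge_ends e.
rewrite (type_coboundaryE _ _ _ Ee) // !ffunE.
have /andP[Lij ijb] := types_adj ST.
case: (ltngtP (type S) (type T)) => [lt|gt|/val_inj eq].
- by rewrite (voltage_reading_adj inv Ee) rd_s // /type_edge lt -ltnS ltn_ord Lij.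
- rewrite setUC in Ee; rewrite (voltage_reading_adj inv Ee) rd_s; first exact: addrC.
  by rewrite /type_edge gt -ltnS ltn_ord addnC Lij.
rewrite eq [RHS](F2_addxx (s (type T))); apply/eqP.
apply: (forall_inP loop); apply/forall_inP=> S'; rewrite Ee => /set2P S'E.
apply/forall_inP=> T' /set2P T'E.
by case: S'E => ->; case: T'E => ->; rewrite ?eq.
Qed.

End Kneser.

(** * Counting the coordinates *)

Section GaussBinomial.

Local Notation q := ('X : {poly rat}).

Definition geometric n : {poly rat} := \sum_(k < n) q ^+ k.

(** The generating function of the 2-subsets of [{0, ..., n - 1}] by their sum, shifted by
    the least sum [0 + 1]. *)
Definition pair_gf n : {poly rat} := \sum_(i < n) \sum_(k < i) q ^+ (k + i - 1).

(** The same for 3-subsets, with least sum [0 + 1 + 2]. *)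
Definition triple_gf n : {poly rat} :=
  \sum_(j < n) \sum_(i < j) \sum_(k < i) q ^+ (k + i + j - 3).

Lemma pair_gf_closed n : (q - 1) * (q ^+ 2 - 1) * pair_gf n = (q ^+ n - 1) * (q ^+ n.-1 - 1).
Proof.
elim: n => [|n IHn]; first by rewrite /pair_gf big_ord0 /= !expr0 subrr !mulr0.
rewrite /pair_gf big_ord_recr /= -/(pair_gf n) mulrDr IHn.
case: n {IHn} => [|n]; first by rewrite big_ord0 /= !expr0 subrr !mulr0 addr0.
have -> : \sum_(k < n.+1) q ^+ (k + n.+1 - 1) = q ^+ n * geometric n.+1.
  by rewrite mulr_sumr; apply: eq_bigr => k _; rewrite -exprD addnS subn1 addnC.
have s1 : (q - 1) * geometric n.+1 = q ^+ n.+1 - 1 by rewrite subrX1.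
transitivity ((q ^+ n.+1 - 1) * (q ^+ n - 1) +
    (q ^+ 2 - 1) * q ^+ n * ((q - 1) * geometric n.+1)); first by rewrite /=; ring.
by rewrite s1 /= !exprS; ring.
Qed.

(** Splitting off the largest element [n] of a subset of [{0, ..., n}] gives the
    recursion of the Gaussian binomials. *)
Lemma triple_gf_closed n : (q - 1) * (q ^+ 2 - 1) * (q ^+ 3 - 1) * triple_gf n =
  (q ^+ n - 1) * (q ^+ n.-1 - 1) * (q ^+ n.-2 - 1).
Proof.
elim: n => [|n IHn]; first by rewrite /triple_gf big_ord0 /= !expr0 subrr !mulr0.
rewrite /triple_gf big_ord_recr /= -/(triple_gf n) mulrDr IHn.
case: n {IHn} => [|[|n]].
- by rewrite big_ord0 !expr0 !subrr !mulr0 addr0.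
- by rewrite big_ord_recr !big_ord0 /= !expr0 !subrr !(mulr0, mul0r, addr0).
have -> : \sum_(i < n.+2) \sum_(k < i) q ^+ (k + i + n.+2 - 3) = q ^+ n * pair_gf n.+2.
  rewrite mulr_sumr; apply: eq_bigr => i _; rewrite mulr_sumr; apply: eq_bigr => k _.
  by rewrite -exprD; congr (_ ^+ _); have := ltn_ord k; lia.
transitivity ((q ^+ n.+2 - 1) * (q ^+ n.+1 - 1) * (q ^+ n - 1) +
    (q ^+ 3 - 1) * q ^+ n * ((q - 1) * (q ^+ 2 - 1) * pair_gf n.+2)); first by rewrite /=; ring.
by rewrite pair_gf_closed /= !exprS; ring.
Qed.

Lemma gauss_binomial3 n : gauss_binomial n 3 = triple_gf n.
Proof.
have den_neq0 : (q - 1) * (q ^+ 2 - 1) * (q ^+ 3 - 1) != 0.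
  have nz k : q ^+ k.+1 - 1 != 0 by rewrite -size_poly_eq0 size_XnsubC.
  by rewrite !mulf_neq0 ?nz // -['X]expr1 nz.
rewrite /gauss_binomial !big_ord_recl !big_ord0 /= !mulr1 !subn0 /bump /= !addn0 add1n.
by rewrite subn1 subn2 !mulrA -triple_gf_closed [X in X %/ _]mulrC expr1 mulpK.
Qed.

(** Nested sums over [k < i < j] and a sum over triples of one index type are compared
    term by term after all the ranges have been made equal. *)
Lemma sum_ord_widen (R : nmodType) n N (F : nat -> R) : (n <= N)%N ->
  \sum_(i < n) F i = \sum_(i < N) if (i < n)%N then F i else 0.
Proof. by move=> le_nN; rewrite (big_ord_widen N F le_nN) big_mkcond. Qed.

Lemma card_ctriple n m : #|{: ctriple n (m + 5)}|%:R = (triple_gf n)`_m.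
Proof.
rewrite card_sig -sum1_card natr_sum big_mkcond /=.
rewrite (eq_bigr (fun x => if @is_ctriple n (m + 5) (x.1, x.2) then 1%:R else 0));
  last by case.
rewrite -(pair_bigA _ (fun p j => if @is_ctriple n (m + 5) (p, j) then 1%:R else 0)).
rewrite exchange_big /= coef_sum (sum_ord_widen (N := n.+1)
  (fun j => (\sum_(i < j) \sum_(k < i) q ^+ (k + i + j - 3))`_m)) //.
apply: eq_bigr => j _.
rewrite (eq_bigr (fun p => if @is_ctriple n (m + 5) (p.1, p.2, j) then 1%:R else 0));
  last by case.
rewrite -(pair_bigA _ (fun k i => if @is_ctriple n (m + 5) (k, i, j) then 1%:R else 0)).
rewrite exchange_big /=; case: ltnP => [lt_jn|le_nj]; last first.
  rewrite big1 // => i _; rewrite big1 // => k _; rewrite ifF //.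
  by apply/negbTE/negP; rewrite /is_ctriple => /and4P[ki ij]; lia.
rewrite coef_sum (sum_ord_widen (N := n.+1)
  (fun i => (\sum_(k < i) q ^+ (k + i + j - 3))`_m)); last exact: ltnW.
apply: eq_bigr => i _; case: ltnP => [lt_ij|le_ji]; last first.
  rewrite big1 // => k _; rewrite ifF //.
  by apply/negbTE/negP; rewrite /is_ctriple => /and4P[ki ij]; lia.
rewrite coef_sum (sum_ord_widen (N := n.+1) (fun k => (q ^+ (k + i + j - 3))`_m)); last exact: ltnW.
apply: eq_bigr => k _; rewrite coefXn /is_ctriple /=.
have -> : (j <= n.-1)%N by lia.
case: (ltnP k i) => //= ki; have -> : (m == k + i + j - 3)%N = (k + i + j + 2 == m + 5)%N by lia.
by case: eqP.
Qed.

Lemma triple_pairE n b (x : ctriple n b) :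
  triple_pair x = [set (val x).1.2; (val x).2] /\ ((val x).1.2 < (val x).2)%N.
Proof.
by case: x => -[[k i] j] /= x_triple; split=> //; have /and3P[] := x_triple.
Qed.

Lemma triple_pair_inj n b : injective (@triple_pair n b).
Proof.
move=> x y; have [[-> ijx] [-> ijy]] := (triple_pairE x, triple_pairE y).
by move=> /(sorted_pair_inj ijx ijy)[Ei Ej]; apply: coord_inj; rewrite /coord_i /coord_j ?Ei ?Ej.
Qed.

Lemma card_Fset n b : #|Fset n b| = #|{: ctriple n b}|.
Proof. by rewrite card_imset //; apply: triple_pair_inj. Qed.

Lemma card_ctriple_gauss n b :
  #|{: ctriple n b}|%:R = coefz (gauss_binomial n 3) (b%:Z - 5).
Proof.
rewrite gauss_binomial3; have [b5|b5] := leqP 5 b.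
  have -> : b%:Z - 5 = Posz (b - 5) by lia.
  by rewrite /= -card_ctriple subnK.
have -> : b%:Z - 5 = Negz (4 - b) by lia.
rewrite /= (_ : #|_| = 0%N) //; apply: eq_card0 => -[[[k i] j] /= x_triple].
by have /and4P[ki ij _ s] := x_triple; exfalso; lia.
Qed.

End GaussBinomial.

(** * Canonical representatives *)

Section Tree.

Variables d b : nat.
Hypothesis b_half : (2 * b <= 3 * d + 1)%N.

Lemma tree_edge_Tset (i j : 'I_d.+1) : tree_edge d b i j -> [set i; j] \in Tset d b.
Proof.
rewrite /tree_edge /Tset; case/andP=> ij /orP[/andP[/eqP i0 jr]|/andP[ir /eqP jd]].
  have -> : i = ord0 by apply/val_inj.
  case: eqP => L0; last rewrite inE; last apply/orP; last left.
    by apply: imset_f; rewrite inE; move: jr; lia.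
  by apply: imset_f; rewrite inE -(ltnS j d) ltn_ord andbT; case/andP: jr.
have -> : j = ord_max by apply/val_inj.
case: eqP => [L0|_]; first by rewrite L0 andbF in ir.
by rewrite inE; apply/orP; right; apply: imset_f; rewrite inE.
Qed.

Lemma Tset_tree_edge (X : {set 'I_d.+1}) : X \in Tset d b ->
  exists i j : 'I_d.+1, tree_edge d b i j /\ X = [set i; j].
Proof.
rewrite /Tset; case: eqP => [L0|L_neq0].
  case/imsetP=> j; rewrite inE => jr ->; exists ord0, j; split=> //.
  by rewrite /tree_edge /= L0; move: jr; lia.
case/setUP=> /imsetP[i]; rewrite inE => ir ->.
  exists ord0, i; split=> //; move: ir L_neq0; rewrite /tree_edge /Ytop /Ylow /=; lia.
exists i, ord_max; split=> //; move: ir L_neq0; rewrite /tree_edge /Ytop /Ylow /=; lia.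
Qed.

End Tree.

Section CanonicalRepresentative.

Variables (Omega : finType) (d : nat) (B : {set Omega}).
Hypotheses (d_gt0 : (0 < d)%N) (card_Omega : #|Omega| = (3 * d + 1)%N)
  (b_half : (2 * #|B| <= 3 * d + 1)%N).

Local Notation b := #|B|.
Local Notation voltage := (voltage (@kadj Omega d)).
Implicit Types (alpha beta : voltage) (i j : 'I_d.+1).

Lemma tree_voltage_eq0 alpha : type_invariant B alpha ->
  (forall e, edge_types B e \in Tset d b -> alpha e = 0) ->
  forall i j : nat, tree_edge d b i j -> voltage_reading B alpha i j = 0.
Proof.
move=> inv alpha0 i j t.
have [e [i' [j' [Ei Ej Ee]]]] :=
  exists_typed_edge d_gt0 card_Omega b_half (tree_edge_type b_half t).
have := voltage_readingE inv Ee; rewrite Ei Ej => <-; apply: alpha0.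
by rewrite Ee; apply: (tree_edge_Tset b_half); rewrite Ei Ej.
Qed.

Lemma exists_canonical alpha : admissible B alpha ->
  exists beta, is_type_coboundary B (beta - alpha) /\
    forall e, edge_types B e \in Tset d b -> beta e = 0.
Proof.
case/and3P=> _ inv _.
pose s : {ffun 'I_d.+1 -> 'F_2} :=
  [ffun i : 'I_d.+1 => tree_potential d b (voltage_reading B alpha) i].
exists (alpha + type_coboundary B s); split=> [|e].
  by rewrite addrAC subrr add0r; apply/existsP; exists s.
move=> /(Tset_tree_edge b_half)[i [j [t Ee]]].
have ij : (i < j)%N by case/andP: t.
rewrite ffunE (type_coboundary_types d_gt0 _ ij Ee) (voltage_readingE inv Ee) !ffunE addrA.
exact: normalize_tree t.
Qed.

(** A switching function that is trivial on the tree is constant on the types that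
    occur. *)
Lemma canonical_unique alpha : is_type_coboundary B alpha ->
  (forall e, edge_types B e \in Tset d b -> alpha e = 0) -> alpha = 0.
Proof.
case/existsP=> s /eqP Ealpha alpha0; pose s' k : F2 := s (inord k).
have s'_const : forall k, (k <= Ytop d b)%N -> s' k = s' 0%N.
  apply: (tree_connected b_half) => i j t; apply: F2_eq0.
  have [e [i' [j' [Ei Ej Ee]]]] :=
    exists_typed_edge d_gt0 card_Omega b_half (tree_edge_type b_half t).
  have ij' : (i' < j')%N by rewrite Ei Ej; case/andP: t.
  have := type_coboundary_types d_gt0 s ij' Ee.
  rewrite -Ealpha /s' -Ei -Ej !inord_val => <-; apply: alpha0.
  by rewrite Ee; apply: (tree_edge_Tset b_half); rewrite Ei Ej.
apply/ffunP=> e; have [S [T [Ee ST]]] := edge_ends e.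
have sE (U : kvertex Omega d) : s (ktype B U) = s' 0%N.
  rewrite -(s'_const (ktype B U)) /s' ?inord_val //.
  by rewrite /Ytop leq_min -ltnS ltn_ord /= subset_leq_card // subsetIr.
by rewrite Ealpha (type_coboundaryE _ _ _ Ee) // !sE [LHS]F2_addxx ffunE.
Qed.

End CanonicalRepresentative.

(** * Complementing the block *)

Section Complement.

Variables (Omega : finType) (d : nat) (A : {set Omega}).

Lemma ktype_setC (S : kvertex Omega d) : ktype (~: A) S = rev_ord (ktype A S).
Proof. by apply/val_inj; rewrite /= subSS -(card_outside A S). Qed.

Lemma edge_types_setC (e : edge (@kadj Omega d)) :
  edge_types (~: A) e = [set rev_ord t | t in edge_types A e].
Proof.
rewrite /edge_types -imset_comp; apply: eq_imset => S; exact: ktype_setC.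
Qed.

Lemma admissible_setC (alpha : voltage (@kadj Omega d)) :
  admissible (~: A) alpha = admissible A alpha.
Proof.
congr [&& _, _ & _].
  apply: eq_forallb => e; congr (_ ==> _).
  apply: eq_forallb => S; congr (_ ==> _); apply: eq_forallb => T; congr (_ ==> _).
  by rewrite !ktype_setC (inj_eq rev_ord_inj).
apply: eq_forallb => e; apply: eq_forallb => e'; congr (_ ==> _).
by rewrite !edge_types_setC (inj_eq (imset_inj rev_ord_inj)).
Qed.

Lemma is_type_coboundary_setC (alpha : voltage (@kadj Omega d)) :
  is_type_coboundary (~: A) alpha = is_type_coboundary A alpha.
Proof.
have revE s : type_coboundary (~: A) s =
    type_coboundary A (fun t : 'I_d.+1 => s (rev_ord t)) :> voltage (@kadj Omega d).
  by apply/ffunP=> e; rewrite !ffunE; apply: eq_bigr => S _; rewrite ktype_setC.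
apply/existsP/existsP=> -[s /eqP->]; exists [ffun t => s (rev_ord t)]; apply/eqP.
  by rewrite revE; apply/ffunP=> e; rewrite !ffunE; apply: eq_bigr => S _; rewrite ffunE.
by rewrite revE; apply/ffunP=> e; rewrite !ffunE; apply: eq_bigr => S _;
  rewrite ffunE rev_ordK.
Qed.

Lemma admissible_canon (alpha : voltage (@kadj Omega d)) :
  admissible (canon_block d A) alpha = admissible A alpha.
Proof. by rewrite /canon_block; case: ifP => _ //; apply: admissible_setC. Qed.

Lemma is_type_coboundary_canon (alpha : voltage (@kadj Omega d)) :
  is_type_coboundary (canon_block d A) alpha = is_type_coboundary A alpha.
Proof. by rewrite /canon_block; case: ifP => _ //; apply: is_type_coboundary_setC. Qed.

Hypothesis card_Omega : #|Omega| = (3 * d + 1)%N.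

Lemma card_canon_block : #|canon_block d A| = canon_size d A.
Proof.
have := cardsC A; rewrite card_Omega /canon_block /canon_size => cA.
by case: ifP; lia.
Qed.

Lemma canon_block_half : (2 * #|canon_block d A| <= 3 * d + 1)%N.
Proof. by rewrite card_canon_block /canon_size; lia. Qed.

End Complement.

(** * Coboundaries between type-invariant voltages *)

Section CoboundaryTypes.

Variables (Omega : finType) (d : nat) (A : {set Omega}).
Hypotheses (d_gt0 : (0 < d)%N) (card_Omega : #|Omega| = (3 * d + 1)%N).

(** The union of two vertices misses at least [d + 1] points. *)
Lemma common_neighbor (S T : kvertex Omega d) : exists W, kadj S W /\ kadj T W.
Proof.
have [|X XP cX] := @exists_subset _ (~: (val S :|: val T)) d.
  have := cardsC (val S :|: val T); have := leq_card_setU (val S) (val T).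
  rewrite (eqP (valP S)) (eqP (valP T)) card_Omega => -[+ _]; lia.
have /eqP cX' := cX; exists (exist (fun S : {set Omega} => #|S| == d) _ cX').
by rewrite /kadj /=; split; rewrite disjoint_sym disjoints_subset (subset_trans XP) //
  setCS ?subsetUl ?subsetUr.
Qed.

(** Vertices [S], [T] of equal type with common neighbor [W] give edges [SW], [TW] of
    equal types, so [f S + f W = f T + f W]. *)
Lemma coboundary_type_invariant (f : kvertex Omega d -> F2) :
  type_invariant A (coboundary (@kadj Omega d) f) ->
  exists s, coboundary (@kadj Omega d) f = type_coboundary A s.
Proof.
move=> /forallP inv.
have fE e S T : val e = [set S; T] -> kadj S T ->
    coboundary (@kadj Omega d) f e = f S + f T.
  move=> Ee ST; rewrite ffunE Ee big_setU1 ?big_set1 // inE.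
  by apply: contraTneq ST => ->; rewrite kadj_irr.
have f_type S T : ktype A S = ktype A T -> f S = f T.
  move=> tST; have [W [SW TW]] := common_neighbor S T.
  have /(edgeP (@kadj_sym _ _) (kadj_irr d_gt0))[e Ee] := SW.
  have /(edgeP (@kadj_sym _ _) (kadj_irr d_gt0))[e' Ee'] := TW.
  have /forallP/(_ e')/implyP := inv e.
  rewrite (fE _ _ _ Ee) // (fE _ _ _ Ee') // (edge_typesE _ Ee) (edge_typesE _ Ee') tST.
  by move=> /(_ (eqxx _))/eqP/addIr.
exists (fun i => if [pick T | ktype A T == i] is Some T then f T else 0).
apply/ffunP=> e; rewrite !ffunE; apply: eq_bigr => S _.
by case: pickP => [T /eqP/f_type //|/(_ S)]; rewrite eqxx.
Qed.

End CoboundaryTypes.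

(** * The theorem *)

Theorem theorem4p3 (d : nat) (Omega : finType) (A : {set Omega})
    (hd : (3 <= d)%N) (hOmega : #|Omega| = (3 * d + 1)%N) :
  let a' := canon_size d A in
  let A' := canon_block d A in
  [/\ (* every gauge class has a unique canonical representative *)
      forall alpha : voltage (@kadj Omega d), admissible A alpha ->
        exists! beta : voltage (@kadj Omega d), canon_rep A alpha beta,
      (* every coordinate (k, i, j) is read on at least one edge *)
      forall x : ctriple d a', exists e : edge (@kadj Omega d),
        edge_types A' e = triple_pair x,
      (* the coordinates of the representative give an isomorphism *)
      exists phi : 'Hom(subvs_of (gauge_quotient d A),
                        {ffun ctriple d a' -> ('F_2)^o}),
        bijective phi /\
        forall alpha beta : voltage (@kadj Omega d),
          admissible A alpha -> canon_rep A alpha beta ->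
          forall (x : ctriple d a') (e : edge (@kadj Omega d)),
            edge_types A' e = triple_pair x ->
            phi (gauge_class A alpha) x = beta e,
      (* dimension *)
      [/\ \dim (gauge_quotient d A) = \dim (H1 (type_complex d a')),
          \dim (H1 (type_complex d a')) = #|Fset d a'|
        & #|Fset d a'|%:R = coefz (gauss_binomial d 3) (a'%:Z - 5)]
    & (* coboundaries between type-invariant voltages are type coboundaries *)
      forall alpha beta : voltage (@kadj Omega d),
        type_invariant A alpha -> type_invariant A beta ->
        (exists f : @kvertex Omega d -> 'F_2,
           beta - alpha = coboundary (@kadj Omega d) f) ->
        exists s : 'I_d.+1 -> 'F_2, beta - alpha = type_coboundary A s].

Proof.
move=> a' A'.
have d_gt0 : (0 < d)%N by apply: leq_trans hd.
have half : (2 * #|A'| <= 3 * d + 1)%N := canon_block_half A hOmega.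
have cA' : #|A'| = a' := card_canon_block A hOmega.
have adE alpha : (alpha \in admissible_space d A) = admissible A' alpha.
  by rewrite mem_admissible_space // admissible_canon.
have gaE alpha : (alpha \in gauge_space d A) = is_type_coboundary A' alpha.
  by rewrite mem_gauge_space is_type_coboundary_canon.
have sVU := gauge_sub_admissible A d_gt0.
pose rd := @voltage_reading Omega d A'.
have U_cocycle alpha : alpha \in admissible_space d A -> type_cocycle d a' (rd alpha).
  by rewrite adE -cA'; apply: admissible_cocycle.
have U_onto g : type_cocycle d a' g -> exists2 alpha, alpha \in admissible_space d A
    & forall i j, type_edge d a' i j -> rd alpha i j = g i j.
  rewrite -cA' => /(admissible_onto d_gt0 hOmega half)[alpha ad rdE].
  by exists alpha; [rewrite adE | exact: rdE].
have V_cob alpha : alpha \in admissible_space d A -> reflect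
    (exists s : nat -> ('F_2)^o, forall i j, type_edge d a' i j -> rd alpha i j = s i + s j)
    (alpha \in gauge_space d A).
  rewrite adE gaE -cA' => ad; exact: (gaugeP d_gt0 hOmega half ad).
have half' : (2 * a' <= 3 * d + 1)%N by rewrite -cA'.
have rd_lin := @voltage_reading_linear Omega d A'.
split.
- move=> alpha; rewrite -admissible_canon => ad.
  have [beta [cob beta0]] := exists_canonical d_gt0 half ad.
  exists beta; split.
    split=> [|e eT]; first by rewrite -is_type_coboundary_canon.
    by apply: beta0; rewrite cA'.
  move=> beta' [cob' beta'0].
  apply/eqP; rewrite -subr_eq0; apply/eqP.
  apply: (canonical_unique d_gt0 hOmega half) => [|e eT].
    have -> : beta - beta' = (beta - alpha) - (beta' - alpha).
      by rewrite opprB addrA subrK.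
    by rewrite -gaE rpredB // mem_gauge_space // -is_type_coboundary_canon.
  rewrite cA' in eT; rewrite !ffunE beta'0 // beta0 ?subr0 //.
  by rewrite cA'.
- move=> x; have [Ex ijx] := triple_pairE x.
  have cx := coord_edge_type (coord_edgeT x).
  have [e [i [j [Ei Ej Ee]]]] :
      exists (e : edge (@kadj Omega d)) (i j : 'I_d.+1),
      [/\ i = coord_i x :> nat, j = coord_j x :> nat & edge_types A' e = [set i; j]].
    by apply: exists_typed_edge; rewrite // cA'.
  by exists e; rewrite Ee Ex; congr [set _; _]; apply/val_inj.
- have [phi [phi_bij phiE]] := quotient_coordinates rd_lin half' sVU U_cocycle U_onto V_cob.
  exists phi; split=> // alpha beta ad [cob beta0] x e Ee.
  have Ua : alpha \in admissible_space d A by rewrite mem_admissible_space.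
  have Vab : beta - alpha \in gauge_space d A by rewrite mem_gauge_space.
  have Ub : beta \in admissible_space d A.
    by rewrite -[beta](subrK alpha) rpredD // (subvP sVU).
  have -> : gauge_class A alpha = gauge_class A beta.
    by apply/esym/eqP; rewrite quot_class_eq.
  have /and3P[_ inv _] : admissible A' beta by rewrite -adE.
  rewrite phiE // ffunE normalize_id //.
  + have [Ex _] := triple_pairE x.
    by rewrite /coord_i /coord_j /rd -(voltage_readingE inv (etrans Ee Ex)).
  + move=> i j; rewrite -cA'; apply: (tree_voltage_eq0 d_gt0 hOmega half inv) => e' e'T.
    by apply: beta0; rewrite cA' in e'T.
  + exact: coord_edge_type (coord_edgeT x).
- have dim_quot := dim_quotient_coordinates rd_lin half' sVU U_cocycle U_onto V_cob.
  by split; rewrite ?dim_quot ?dim_H1_type_complex ?card_Fset ?card_ctriple_gauss.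
move=> alpha beta inv_a inv_b [f fE].
have [|s sE] := coboundary_type_invariant d_gt0 hOmega (A := A) (f := f).
  rewrite -fE; apply/forallP=> e; apply/forallP=> e'; apply/implyP=> Ee.
  have /forallP/(_ e')/implyP/(_ Ee)/eqP Ea := forallP inv_a e.
  have /forallP/(_ e')/implyP/(_ Ee)/eqP Eb := forallP inv_b e.
  by rewrite !ffunE Ea Eb.
by exists s; rewrite fE.
Qed.
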